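(* Let $T$ be a normal monad on a virtual equipment $\mathbb{X}$. Then: (i) Any oplax $T$-algebra $a:TA\to A$ in the vertical 2-category $\mathcal{V}\mathbb{X}$ gives rise to a $T$-monoid $A(a,1):A\nrightarrow TA$, which is normalized if and only if the oplax $T$-algebra $A$ is normal. (ii) A $T$-monoid $M:A\nrightarrow TA$ arises from an oplax $T$-algebra if and only if $M\cong A(a,1)$ for some vertical arrow $a:TA\to A$.
   Context: **Virtual double categories.** A virtual double category $\mathbb{X}$ consists of: a category (objects and vertical arrows of $\mathbb X$); for each pair of objects $X,Y$ a class of horizontal arrows, written $p: X\nrightarrow Y$; and cells. A cell $\alpha:(p_1,\dots,p_n)\Rightarrow q$ over $(f,g)$ has as source a composable string $p_i:X_{i-1}\nrightarrow X_i$ ($n\ge 0$), as target a horizontal arrow $q:Y_0\nrightarrow Y_1$, left vertical boundary $f:X_0\to Y_0$ and right vertical boundary $g:X_n\to Y_1$ (for $n=0$ the source is the empty string at an object $X_0=X_n$, and we write $()\Rightarrow q$). Given $\beta:(q_1,\dots,q_m)\Rightarrow r$ over $(g_0,g_1)$ and $\alpha_i:(p_{i1},\dots,p_{in_i})\Rightarrow q_i$ over $(f_{i-1},f_i)$, there is a composite cell $\beta(\alpha_1,\dots,\alpha_m):(p_{11},\dots,p_{mn_m})\Rightarrow r$ over $(g_0f_0,g_1f_m)$ (for $m=0$: a nullary cell can be precomposed with a vertical arrow $f_0$); there are identity cells $1_p:(p)\Rightarrow p$ over identities; composition is associative and unital. **Functors, transformations, monads.** A functor preserves all this structure strictly. A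 transformation $\theta:F\to G$ consists of vertical arrows $\theta_X:FX\to GX$, natural in vertical arrows, and cells $\theta_p:(Fp)\Rightarrow Gp$ over $(\theta_X,\theta_Y)$ for $p:X\nrightarrow Y$, with $\theta_q(F\alpha)=(G\alpha)(\theta_{p_1},\dots,\theta_{p_n})$ for every cell $\alpha:(p_1,\dots,p_n)\Rightarrow q$. A monad on $\mathbb{X}$ is a monad $(T,\eta,\mu)$ in the resulting 2-category. **Units, composites, restrictions, virtual equipments.** A cell $\gamma:(p_1,\dots,p_n)\Rightarrow q$ over identities is opcartesian if every cell $(r_1,\dots,r_m,p_1,\dots,p_n,s_1,\dots,s_k)\Rightarrow t$ over any $(f,g)$ ($m,k\ge0$) factors uniquely as $\delta(1_{r_1},\dots,1_{r_m},\gamma,1_{s_1},\dots,1_{s_k})$; then $q$ is the composite $p_1\odot\cdots\odot p_n$. If $n=0$ and the source is at $X$, $q$ is the unit $U_X:X\nrightarrow X$. A cell $(p)\Rightarrow q$ over $(f,g)$ is cartesian if every cell $(r_1,\dots,r_n)\Rightarrow q$ over $(fh,gk)$ factors uniquely through it via a cell $(r_1,\dots,r_n)\Rightarrow p$ over $(h,k)$; then $p$ is the restriction $q(g,f)$. A virtual equipment is a virtual double category in which all units and all restrictions exist. For $f:A\to B$ put $B(1,f)=U_B(1,f):A\nrightarrow B$ and $B(f,1)=U_B(f,1):B\nrightarrow A$. A functor (or monad) is normal if it preserves opcartesian cells with nullary source (i.e. units). **Vertical 2-category.** For $\mathbb{X}$ with units, $\mathcal{V}\mathbb{X}$ has the objects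 and vertical arrows of $\mathbb{X}$, and a 2-cell $f\Rightarrow g:A\to B$ is a cell $(U_A)\Rightarrow U_B$ over $(g,f)$. A normal monad $T$ induces a 2-monad $\mathcal{V}(T)$ on $\mathcal{V}\mathbb{X}$; ''$T$-algebra'' (oplax etc.) means $\mathcal{V}(T)$-algebra. In a virtual equipment, 2-cells $f\Rightarrow g:A\to B$ correspond bijectively to cells $(B(g,1))\Rightarrow B(f,1)$ over identities. **Oplax algebras.** For a 2-monad $T$, an oplax $T$-algebra is an object $A$ with a morphism $a:TA\to A$ and 2-cells $\bar a: a\circ\mu_A\Rightarrow a\circ Ta$ and $\hat a: a\circ\eta_A\Rightarrow 1_A$ such that: $(\bar a\cdot T^2a)(\bar a\cdot\mu_{TA})=(a\cdot T\bar a)(\bar a\cdot T\mu_A)$ as 2-cells $a\mu_A\mu_{TA}=a\mu_A T\mu_A\Rightarrow a\,Ta\,T^2a$; $(\hat a\cdot a)(\bar a\cdot\eta_{TA})=1_a$; and $(a\cdot T\hat a)(\bar a\cdot T\eta_A)=1_a$. It is normal if $\hat a$ is an isomorphism. **$T$-monoids.** A $T$-monoid is an object $A$ with a horizontal arrow $M:A\nrightarrow TA$, a multiplication cell $(M,TM)\Rightarrow M$ over $(1_A,\mu_A)$ and a unit cell $()\Rightarrow M$ over $(1_A,\eta_A)$, satisfying associativity and unit axioms (it is a monoid in the horizontal Kleisli virtual double category of $T$, whose horizontal arrows $X\nrightarrow Y$ are horizontal arrows $X\nrightarrow TY$ of $\mathbb X$, with composition of cells using $\mu$, $\eta$ and the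 action of $T$ on cells). It is normalized if its unit, regarded as a cell $(U_A)\Rightarrow M$ over $(1_A,\eta_A)$, is cartesian. **How an oplax algebra gives rise to a $T$-monoid.** The $T$-monoid arising from $(A,a,\bar a,\hat a)$ has underlying horizontal arrow $A(a,1):A\nrightarrow TA$; its unit is the cell $()\Rightarrow A(a,1)$ over $(1,\eta_A)$ corresponding, by the universal properties of $A(a,1)$ and $U_A$, to $\hat a$ (a cell $(U_A)\Rightarrow U_A$ over $(1,a\eta_A)$); its multiplication is the cell $(A(a,1),T(A(a,1)))\Rightarrow A(a,1)$ over $(1,\mu_A)$ corresponding to $\bar a$ via the isomorphisms $T(A(a,1))\cong (TA)(Ta,1)$ (normality of $T$), $A(a,1)\odot(TA)(Ta,1)\cong A(a\circ Ta,1)$, $A(a\mu_A,1)\cong A(a,1)(\mu_A,1)$ and the bijection above between 2-cells $a\mu_A\Rightarrow a\circ Ta$ and cells $A(a\circ Ta,1)\Rightarrow A(a\mu_A,1)$. *)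

(* Defs.v *)
From Stdlib Require Import ClassicalEpsilon.

Set Implicit Arguments.
Unset Strict Implicit.
Unset Printing Implicit Defensive.

Inductive hpath (ob : Type) (hor : ob -> ob -> Type) : ob -> ob -> Type :=
| hnil X : hpath hor X X
| hcons X Y Z (p : hor X Y) (ps : hpath hor Y Z) : hpath hor X Z.

Arguments hnil {ob hor} X.
Arguments hcons {ob hor X Y Z} p ps.

Declare Scope vdc_scope.
Delimit Scope vdc_scope with vdc.
Open Scope vdc_scope.

Notation "p :-: ps" := (hcons p ps) (at level 60, right associativity) : vdc_scope.
Notation "⟦ p ⟧" := (hcons p (hnil _)) (at level 0) : vdc_scope.
Notation "⟦ p ; q ⟧" := (hcons p (hcons q (hnil _))) (at level 0) : vdc_scope.

Fixpoint happ (ob : Type) (hor : ob -> ob -> Type) (X Y Z : ob)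
    (ps : hpath hor X Y) : hpath hor Y Z -> hpath hor X Z :=
  match ps with
  | hnil _ => fun qs => qs
  | hcons p ps' => fun qs => hcons p (happ ps' qs)
  end.

(* A string of cells α_i : (p_i1 .. p_in_i) => q_i over (f_(i-1), f_i).  It is
   indexed by its target string and its two outer boundaries; its source, the
   concatenation of the sources of the α_i, is computed by [cs_src].  The empty
   string is a vertical arrow. *)
Inductive cellseq (ob : Type) (ver hor : ob -> ob -> Type)
    (cell : forall X0 X1 Y0 Y1 : ob,
        hpath hor X0 X1 -> hor Y0 Y1 -> ver X0 Y0 -> ver X1 Y1 -> Type) :
    forall X0 X1 Y0 Y1 : ob,
      hpath hor Y0 Y1 -> ver X0 Y0 -> ver X1 Y1 -> Type :=
| csnil X Y (f : ver X Y) : @cellseq ob ver hor cell X X Y Y (hnil Y) f f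
| cscons X0 X1 X2 Y0 Y1 Y2 (ps : hpath hor X0 X1) (q : hor Y0 Y1)
    (qs : hpath hor Y1 Y2) (f0 : ver X0 Y0) (f1 : ver X1 Y1) (f2 : ver X2 Y2)
    (α : @cell X0 X1 Y0 Y1 ps q f0 f1)
    (αs : @cellseq ob ver hor cell X1 X2 Y1 Y2 qs f1 f2) :
    @cellseq ob ver hor cell X0 X2 Y0 Y2 (hcons q qs) f0 f2.

Fixpoint cs_src ob ver hor cell X0 X1 Y0 Y1 (qs : hpath hor Y0 Y1)
    (f : ver X0 Y0) (g : ver X1 Y1) (αs : @cellseq ob ver hor cell _ _ _ _ qs f g) :
    hpath hor X0 X1 :=
  match αs in @cellseq _ _ _ _ X0 X1 _ _ _ _ _ return hpath hor X0 X1 with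
  | csnil _ f => hnil _
  | @cscons _ _ _ _ _ _ _ _ _ _ ps _ _ _ _ _ _ αs' => happ ps (cs_src αs')
  end.

(* [cell ps q f g] is the type of cells [ps => q] over [(f, g)]. *)
Record vdc_data := VDCData {
  ob :> Type;
  ver : ob -> ob -> Type;
  hor : ob -> ob -> Type;
  vid : forall X, ver X X;
  vcomp : forall X Y Z, ver Y Z -> ver X Y -> ver X Z;
  cell : forall X0 X1 Y0 Y1,
    hpath hor X0 X1 -> hor Y0 Y1 -> ver X0 Y0 -> ver X1 Y1 -> Type;
  cid : forall X Y (p : hor X Y), cell ⟦p⟧ p (vid X) (vid Y);
  ccomp : forall X0 X1 Y0 Y1 Z0 Z1 (qs : hpath hor Y0 Y1) (r : hor Z0 Z1)
    (g0 : ver Y0 Z0) (g1 : ver Y1 Z1) (f0 : ver X0 Y0) (f1 : ver X1 Y1),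
    cell qs r g0 g1 -> forall αs : cellseq cell qs f0 f1,
    cell (cs_src αs) r (vcomp g0 f0) (vcomp g1 f1) }.

Arguments ver {v} _ _.
Arguments hor {v} _ _.
Arguments vid {v} X.
Arguments vcomp {v X Y Z} _ _.
Arguments cell {v X0 X1 Y0 Y1} _ _ _ _.
Arguments cid {v X Y} p.
Arguments ccomp {v X0 X1 Y0 Y1 Z0 Z1 qs r g0 g1 f0 f1} _ _.

Notation "g ∘ f" := (vcomp g f) (at level 40, left associativity) : vdc_scope.
Notation "'𝟙'" := (vid _) : vdc_scope.

Notation path X := (hpath (@hor X)).
Notation cells X := (@cellseq (ob X) (@ver X) (@hor X) (@cell X) _ _ _ _).

(* Transport of a cell along equalities of its source string and of its vertical
   boundaries. *)
Definition cast (X : vdc_data) (X0 X1 Y0 Y1 : X) (ps ps' : path X X0 X1)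
    (q : hor Y0 Y1) (f f' : ver X0 Y0) (g g' : ver X1 Y1)
    (ep : ps = ps') (ef : f = f') (eg : g = g') (α : cell ps q f g) :
    cell ps' q f' g' :=
  match ep in _ = ps', ef in _ = f', eg in _ = g' return cell ps' q f' g' with
  | eq_refl, eq_refl, eq_refl => α
  end.

Notation vcast ef eg α := (cast eq_refl ef eg α).

(* Equality of cells whose sources and boundaries are only provably equal. *)
Definition ceq (X : vdc_data) (X0 X1 Y0 Y1 : X) (ps ps' : path X X0 X1)
    (q : hor Y0 Y1) (f f' : ver X0 Y0) (g g' : ver X1 Y1)
    (α : cell ps q f g) (α' : cell ps' q f' g') : Prop :=
  exists (ep : ps = ps') (ef : f = f') (eg : g = g'), cast ep ef eg α = α'.

Notation "α ≡ β" := (ceq α β) (at level 70, no associativity) : vdc_scope.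

Section CellStrings.
Context {X : vdc_data}.

Fixpoint cs_app (X0 X1 X2 Y0 Y1 Y2 : X) (qs : path X Y0 Y1) (qs' : path X Y1 Y2)
    (f0 : ver X0 Y0) (f1 : ver X1 Y1) (f2 : ver X2 Y2) (αs : cells X qs f0 f1) :
    cells X qs' f1 f2 -> cells X (happ qs qs') f0 f2 :=
  match αs in @cellseq _ _ _ _ _ X1 _ Y1 qs f0 f1
    return forall qs' : path X Y1 Y2,
      cells X qs' f1 f2 -> cells X (happ qs qs') f0 f2
  with
  | csnil _ _ => fun _ βs => βs
  | cscons α αs' => fun _ βs => cscons α (cs_app αs' βs)
  end qs'.

Fixpoint cs_id (Y0 Y1 : X) (qs : path X Y0 Y1) : cells X qs (vid Y0) (vid Y1) :=
  match qs with
  | hnil _ => csnil _ _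
  | hcons q qs' => cscons (cid q) (cs_id qs')
  end.

Definition ccomp0 (Z Y Y0 Y1 : X) (r : hor Y0 Y1) (g0 : ver Y Y0) (g1 : ver Y Y1)
    (β : cell (hnil Y) r g0 g1) (f : ver Z Y) : cell (hnil Z) r (g0 ∘ f) (g1 ∘ f) :=
  ccomp β (csnil _ f).

Definition ccomp1 (X0 X1 Y0 Y1 Z0 Z1 : X) (ps : path X X0 X1) (q : hor Y0 Y1)
    (r : hor Z0 Z1) (g0 : ver Y0 Z0) (g1 : ver Y1 Z1) (f0 : ver X0 Y0) (f1 : ver X1 Y1)
    (β : cell ⟦q⟧ r g0 g1) (α : cell ps q f0 f1) :
    cell (happ ps (hnil X1)) r (g0 ∘ f0) (g1 ∘ f1) :=
  ccomp β (cscons α (csnil _ f1)).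

Definition ccomp2 (X0 X1 X2 Y0 Y1 Y2 Z0 Z1 : X) (ps : path X X0 X1)
    (ps' : path X X1 X2) (q : hor Y0 Y1) (q' : hor Y1 Y2) (r : hor Z0 Z1)
    (g0 : ver Y0 Z0) (g2 : ver Y2 Z1)
    (f0 : ver X0 Y0) (f1 : ver X1 Y1) (f2 : ver X2 Y2)
    (β : cell ⟦q; q'⟧ r g0 g2) (α : cell ps q f0 f1) (α' : cell ps' q' f1 f2) :
    cell (happ ps (happ ps' (hnil X2))) r (g0 ∘ f0) (g2 ∘ f2) :=
  ccomp β (cscons α (cscons α' (csnil _ f2))).

(* A two-level string: cells β_i, together with, for each i, a string of cells
   composable with β_i.  The associativity law compares the two ways of
   composing it with a further cell. *)
Inductive celltree : forall X0 X1 Y0 Y1 Z0 Z1 : X, path X Z0 Z1 ->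
    ver X0 Y0 -> ver X1 Y1 -> ver Y0 Z0 -> ver Y1 Z1 -> Type :=
| ctnil A Y Z (f : ver A Y) (g : ver Y Z) : celltree (hnil Z) f f g g
| ctcons X0 X1 X2 Y0 Y1 Y2 Z0 Z1 Z2 (qs : path X Y0 Y1) (r : hor Z0 Z1)
    (rs : path X Z1 Z2)
    (f0 : ver X0 Y0) (f1 : ver X1 Y1) (f2 : ver X2 Y2)
    (g0 : ver Y0 Z0) (g1 : ver Y1 Z1) (g2 : ver Y2 Z2)
    (β : cell qs r g0 g1) (αs : cells X qs f0 f1)
    (t : celltree rs f1 f2 g1 g2) : celltree (hcons r rs) f0 f2 g0 g2.

Fixpoint ct_outer (X0 X1 Y0 Y1 Z0 Z1 : X) (rs : path X Z0 Z1)
    (f0 : ver X0 Y0) (f1 : ver X1 Y1) (g0 : ver Y0 Z0) (g1 : ver Y1 Z1)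
    (t : celltree rs f0 f1 g0 g1) : cells X rs g0 g1 :=
  match t in celltree rs _ _ g0 g1 return cells X rs g0 g1 with
  | ctnil _ g => csnil _ g
  | ctcons β _ t' => cscons β (ct_outer t')
  end.

Fixpoint ct_inner (X0 X1 Y0 Y1 Z0 Z1 : X) (rs : path X Z0 Z1)
    (f0 : ver X0 Y0) (f1 : ver X1 Y1) (g0 : ver Y0 Z0) (g1 : ver Y1 Z1)
    (t : celltree rs f0 f1 g0 g1) : cells X (cs_src (ct_outer t)) f0 f1 :=
  match t as t in celltree _ f0 f1 _ _ return cells X (cs_src (ct_outer t)) f0 f1 with
  | ctnil f _ => csnil _ f
  | ctcons _ αs t' => cs_app αs (ct_inner t')
  end.

Fixpoint ct_comp (X0 X1 Y0 Y1 Z0 Z1 : X) (rs : path X Z0 Z1)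
    (f0 : ver X0 Y0) (f1 : ver X1 Y1) (g0 : ver Y0 Z0) (g1 : ver Y1 Z1)
    (t : celltree rs f0 f1 g0 g1) : cells X rs (g0 ∘ f0) (g1 ∘ f1) :=
  match t in celltree rs f0 f1 g0 g1 return cells X rs (g0 ∘ f0) (g1 ∘ f1) with
  | ctnil f g => csnil _ (g ∘ f)
  | ctcons β αs t' => cscons (ccomp β αs) (ct_comp t')
  end.

End CellStrings.

Record vdc := VDC {
  vdc_dat :> vdc_data;
  vidl : forall (X Y : vdc_dat) (f : ver X Y), vid Y ∘ f = f;
  vidr : forall (X Y : vdc_dat) (f : ver X Y), f ∘ vid X = f;
  vassoc : forall (X Y Z W : vdc_dat) (h : ver Z W) (g : ver Y Z) (f : ver X Y),
    h ∘ (g ∘ f) = (h ∘ g) ∘ f;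
  ccomp_idl : forall (X0 X1 Y0 Y1 : vdc_dat) (ps : path vdc_dat X0 X1)
    (q : hor Y0 Y1) (f : ver X0 Y0) (g : ver X1 Y1) (α : cell ps q f g),
    ccomp1 (cid q) α ≡ α;
  ccomp_idr : forall (X0 X1 Y0 Y1 : vdc_dat) (ps : path vdc_dat X0 X1)
    (q : hor Y0 Y1) (f : ver X0 Y0) (g : ver X1 Y1) (α : cell ps q f g),
    ccomp α (cs_id ps) ≡ α;
  ccomp_assoc : forall (X0 X1 Y0 Y1 Z0 Z1 W0 W1 : vdc_dat) (rs : path vdc_dat Z0 Z1)
    (s : hor W0 W1) (h0 : ver Z0 W0) (h1 : ver Z1 W1)
    (g0 : ver Y0 Z0) (g1 : ver Y1 Z1) (f0 : ver X0 Y0) (f1 : ver X1 Y1)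
    (γ : cell rs s h0 h1) (t : celltree rs f0 f1 g0 g1),
    ccomp (ccomp γ (ct_outer t)) (ct_inner t) ≡ ccomp γ (ct_comp t) }.

Fixpoint path_map (O O' : Type) (H : O -> O -> Type) (H' : O' -> O' -> Type)
    (F : O -> O') (Fh : forall X Y, H X Y -> H' (F X) (F Y)) (X Y : O)
    (ps : hpath H X Y) : hpath H' (F X) (F Y) :=
  match ps with
  | hnil _ => hnil _
  | hcons p ps' => hcons (Fh _ _ p) (path_map Fh ps')
  end.

Record functor_data (X Y : vdc_data) := FunctorData {
  fob :> X -> Y;
  fver : forall A B : X, ver A B -> ver (fob A) (fob B);
  fhor : forall A B : X, hor A B -> hor (fob A) (fob B);
  fcell : forall (A0 A1 B0 B1 : X) (ps : path X A0 A1) (q : hor B0 B1)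
    (f : ver A0 B0) (g : ver A1 B1), cell ps q f g ->
    cell (path_map fhor ps) (fhor q) (fver f) (fver g) }.

Arguments fver {X Y} F {A B} _ : rename.
Arguments fhor {X Y} F {A B} _ : rename.
Arguments fcell {X Y} F {A0 A1 B0 B1 ps q f g} _ : rename.

Fixpoint fcells (X Y : vdc_data) (F : functor_data X Y) (X0 X1 Y0 Y1 : X)
    (qs : path X Y0 Y1) (f : ver X0 Y0) (g : ver X1 Y1) (αs : cells X qs f g) :
    cells Y (path_map (@fhor X Y F) qs) (fver F f) (fver F g) :=
  match αs in cellseq _ qs f g
    return cells Y (path_map (@fhor X Y F) qs) (fver F f) (fver F g) with
  | csnil _ f => csnil _ (fver F f)
  | cscons α αs' => cscons (fcell F α) (fcells F αs')
  end.

Record vfunctor (X Y : vdc) := VFunctor {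
  fdat :> functor_data X Y;
  fver_id : forall A : X, fver fdat (vid A) = vid (fdat A);
  fver_comp : forall (A B C : X) (g : ver B C) (f : ver A B),
    fver fdat (g ∘ f) = fver fdat g ∘ fver fdat f;
  fcell_id : forall (A B : X) (p : hor A B), fcell fdat (cid p) ≡ cid (fhor fdat p);
  fcell_comp : forall (X0 X1 Y0 Y1 Z0 Z1 : X) (qs : path X Y0 Y1) (r : hor Z0 Z1)
    (g0 : ver Y0 Z0) (g1 : ver Y1 Z1) (f0 : ver X0 Y0) (f1 : ver X1 Y1)
    (β : cell qs r g0 g1) (αs : cells X qs f0 f1),
    fcell fdat (ccomp β αs) ≡ ccomp (fcell fdat β) (fcells fdat αs) }.

Lemma path_map_id (O : Type) (H : O -> O -> Type) (X Y : O) (ps : hpath H X Y) :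
  ps = path_map (F := fun X => X) (fun X Y (p : H X Y) => p) ps.
Proof. induction ps; simpl; congruence. Qed.

Lemma path_map_comp (O O' O'' : Type) (H : O -> O -> Type) (H' : O' -> O' -> Type)
  (H'' : O'' -> O'' -> Type) (F : O -> O') (G : O' -> O'')
  (Fh : forall X Y, H X Y -> H' (F X) (F Y))
  (Gh : forall X Y, H' X Y -> H'' (G X) (G Y)) (X Y : O) (ps : hpath H X Y) :
  path_map Gh (path_map Fh ps)
  = path_map (F := fun X => G (F X)) (fun X Y p => Gh _ _ (Fh X Y p)) ps.
Proof. induction ps; simpl; congruence. Qed.

Definition id_functor (X : vdc_data) : functor_data X X :=
  @FunctorData X X (fun A => A) (fun _ _ f => f) (fun _ _ p => p)
    (fun _ _ _ _ ps _ _ _ α => cast (path_map_id ps) eq_refl eq_refl α).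

Definition comp_functor (X Y Z : vdc_data) (G : functor_data Y Z)
    (F : functor_data X Y) : functor_data X Z :=
  @FunctorData X Z (fun A => G (F A)) (fun _ _ f => fver G (fver F f))
    (fun _ _ p => fhor G (fhor F p))
    (fun _ _ _ _ ps _ _ _ α =>
       cast (path_map_comp (@fhor X Y F) (@fhor Y Z G) ps) eq_refl eq_refl (fcell G (fcell F α))).

Fixpoint trans_cells (X Y : vdc_data) (F G : functor_data X Y)
    (θ : forall A, ver (F A) (G A))
    (θh : forall A B (p : hor A B), cell ⟦fhor F p⟧ (fhor G p) (θ A) (θ B))
    (A B : X) (ps : path X A B) :
    cells Y (path_map (@fhor X Y G) ps) (θ A) (θ B) :=
  match ps with
  | hnil _ => csnil _ (θ _)
  | hcons p ps' => cscons (θh _ _ p) (trans_cells θh ps')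
  end.

Record vtrans (X Y : vdc_data) (F G : functor_data X Y) := VTrans {
  tver :> forall A, ver (F A) (G A);
  tcell : forall A B (p : hor A B), cell ⟦fhor F p⟧ (fhor G p) (tver A) (tver B);
  tver_nat : forall A B (f : ver A B), tver B ∘ fver F f = fver G f ∘ tver A;
  tcell_nat : forall (A0 A1 B0 B1 : X) (ps : path X A0 A1) (q : hor B0 B1)
    (f : ver A0 B0) (g : ver A1 B1) (α : cell ps q f g),
    ccomp1 (tcell q) (fcell F α) ≡ ccomp (fcell G α) (trans_cells tcell ps) }.

Arguments tcell {X Y F G} v {A B} p.

(* The monad laws are equations of transformations, spelled out on components. *)
Record vmonad (X : vdc) := VMonad {
  mfun :> vfunctor X X;
  η : vtrans (id_functor X) mfun;
  μ : vtrans (comp_functor mfun mfun) mfun;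
  μ_ηT : forall A : X, μ A ∘ η (mfun A) = vid (mfun A);
  μ_Tη : forall A : X, μ A ∘ fver mfun (η A) = vid (mfun A);
  μ_μT : forall A : X, μ A ∘ μ (mfun A) = μ A ∘ fver mfun (μ A);
  μ_ηT_cell : forall (A B : X) (p : hor A B),
    ccomp1 (tcell μ p) (tcell η (fhor mfun p)) ≡ cid (fhor mfun p);
  μ_Tη_cell : forall (A B : X) (p : hor A B),
    ccomp1 (tcell μ p) (fcell mfun (tcell η p)) ≡ cid (fhor mfun p);
  μ_μT_cell : forall (A B : X) (p : hor A B),
    ccomp1 (tcell μ p) (tcell μ (fhor mfun p))
    ≡ ccomp1 (tcell μ p) (fcell mfun (tcell μ p)) }.

Arguments η {X} T : rename.
Arguments μ {X} T : rename.

Definition opcartesian (X : vdc_data) (X0 X1 : X) (ps : path X X0 X1) (q : hor X0 X1)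
    (γ : cell ps q (vid X0) (vid X1)) : Prop :=
  forall (W0 W1 Z0 Z1 : X) (rs : path X W0 X0) (ss : path X X1 W1) (t : hor Z0 Z1)
    (f : ver W0 Z0) (g : ver W1 Z1) (α : cell (happ rs (happ ps ss)) t f g),
  exists! δ : cell (happ rs (q :-: ss)) t f g,
    ccomp δ (cs_app (cs_id rs) (cscons γ (cs_id ss))) ≡ α.

Definition cartesian (X : vdc_data) (X0 X1 Y0 Y1 : X) (p : hor X0 X1) (q : hor Y0 Y1)
    (f : ver X0 Y0) (g : ver X1 Y1) (κ : cell ⟦p⟧ q f g) : Prop :=
  forall (W0 W1 : X) (rs : path X W0 W1) (h : ver W0 X0) (k : ver W1 X1)
    (α : cell rs q (f ∘ h) (g ∘ k)),
  exists! β : cell rs p h k, ccomp1 κ β ≡ α.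

(* A virtual double category with chosen units [U A] and chosen restrictions
   [res q g f], written q(g,f), along f on the left and g on the right. *)
Record vequipment := VEquipment {
  veq_vdc :> vdc;
  U : forall A : veq_vdc, hor A A;
  ucell : forall A : veq_vdc, cell (hnil A) (U A) (vid A) (vid A);
  ucell_opcart : forall A : veq_vdc, opcartesian (ucell A);
  res : forall (X0 X1 Y0 Y1 : veq_vdc),
    hor Y0 Y1 -> ver X1 Y1 -> ver X0 Y0 -> hor X0 X1;
  rescell : forall (X0 X1 Y0 Y1 : veq_vdc) (q : hor Y0 Y1) (g : ver X1 Y1)
    (f : ver X0 Y0), cell ⟦res q g f⟧ q f g;
  rescell_cart : forall (X0 X1 Y0 Y1 : veq_vdc) (q : hor Y0 Y1) (g : ver X1 Y1)
    (f : ver X0 Y0), cartesian (rescell q g f) }.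

Arguments U {v} A.
Arguments ucell {v} A.
Arguments res {v X0 X1 Y0 Y1} q g f.
Arguments rescell {v X0 X1 Y0 Y1} q g f.

Definition normal_functor (X Y : vdc) (F : vfunctor X Y) : Prop :=
  forall (A : X) (q : hor A A) (γ : cell (hnil A) q (vid A) (vid A)),
    opcartesian γ -> opcartesian (vcast (fver_id F A) (fver_id F A) (fcell F γ)).

Definition the (A : Type) (P : A -> Prop) (H : exists! x, P x) : A :=
  proj1_sig (constructive_definite_description P H).

Definition oplift (X : vdc_data) (X0 X1 : X) (ps : path X X0 X1) (q : hor X0 X1)
    (γ : cell ps q (vid X0) (vid X1)) (Hγ : opcartesian γ)
    (W0 W1 Z0 Z1 : X) (rs : path X W0 X0) (ss : path X X1 W1) (t : hor Z0 Z1)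
    (f : ver W0 Z0) (g : ver W1 Z1) (α : cell (happ rs (happ ps ss)) t f g) :
    cell (happ rs (q :-: ss)) t f g :=
  the (Hγ _ _ _ _ rs ss t f g α).

Definition lift (X : vdc_data) (X0 X1 Y0 Y1 : X) (p : hor X0 X1) (q : hor Y0 Y1)
    (f : ver X0 Y0) (g : ver X1 Y1) (κ : cell ⟦p⟧ q f g) (Hκ : cartesian κ)
    (W0 W1 : X) (rs : path X W0 W1) (h : ver W0 X0) (k : ver W1 X1)
    (u : ver W0 Y0) (v : ver W1 Y1) (eu : u = f ∘ h) (ev : v = g ∘ k)
    (α : cell rs q u v) : cell rs p h k :=
  the (Hκ _ _ rs h k (vcast eu ev α)).

Definition hinverse (X : vdc_data) (A B : X) (p q : hor A B)
    (φ : cell ⟦p⟧ q (vid A) (vid B)) (ψ : cell ⟦q⟧ p (vid A) (vid B)) : Prop :=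
  ccomp1 ψ φ ≡ cid p /\ ccomp1 φ ψ ≡ cid q.

Definition hiso (X : vdc_data) (A B : X) (p q : hor A B) : Prop :=
  exists φ ψ, hinverse (p := p) (q := q) φ ψ.

Section Vertical.
Context {X : vequipment}.

Definition ulift (A Y0 Y1 : X) (q : hor Y0 Y1) (f : ver A Y0) (g : ver A Y1)
    (α : cell (hnil A) q f g) : cell ⟦U A⟧ q f g :=
  oplift (@ucell_opcart X A) (rs := hnil A) (ss := hnil A) α.

(* The cell (U_B, U_B) => U_B restricting to the identity along the unit cell. *)
Definition umult (B : X) : cell ⟦U B; U B⟧ (U B) (vid B) (vid B) :=
  oplift (@ucell_opcart X B) (rs := hnil B) (ss := ⟦U B⟧) (cid (U B)).

(* 2-cells f => g : A -> B; note the reversal of the boundaries. *)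
Definition cell2 (A B : X) (f g : ver A B) : Type := cell ⟦U A⟧ (U B) g f.

(* U_f, which is also the identity 2-cell of f. *)
Definition Uver (A B : X) (f : ver A B) : cell ⟦U A⟧ (U B) f f :=
  ulift (vcast (vidl f) (vidl f) (ccomp0 (ucell B) f)).

Definition id2 (A B : X) (f : ver A B) : cell2 f f := Uver f.

(* The 2-cell ζξ for ξ : f => g and ζ : g' => h with g = g'. *)
Definition comp2 (A B : X) (f g g' h : ver A B) (ζ : cell2 g' h) (e : g = g')
    (ξ : cell2 f g) : cell2 f h :=
  ulift (vcast (eq_trans (vidl _) (vidr h)) (eq_trans (vidl _) (vidr f))
    (ccomp2 (umult B) (ccomp1 ζ (ucell A))
       (vcast (f_equal (fun k => k ∘ 𝟙) e) eq_refl (ccomp1 ξ (ucell A))))).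

Definition whisk_r (A B C : X) (f g : ver A B) (ξ : cell2 f g) (k : ver C A) :
    cell2 (f ∘ k) (g ∘ k) := ccomp1 ξ (Uver k).

Definition whisk_l (A B C : X) (h : ver B C) (f g : ver A B) (ξ : cell2 f g) :
    cell2 (h ∘ f) (h ∘ g) := ccomp1 (Uver h) ξ.

Definition iso2 (A B : X) (f g : ver A B) (ξ : cell2 f g) : Prop :=
  exists ζ : cell2 g f, comp2 ζ eq_refl ξ = id2 f /\ comp2 ξ eq_refl ζ = id2 g.

(* B(f,1) : B -|-> A, and its cartesian cell to U_B over (1, f). *)
Definition conj (A B : X) (f : ver A B) : hor B A := res (U B) f (vid B).

Definition conj_cell (A B : X) (f : ver A B) : cell ⟦conj f⟧ (U B) (vid B) f :=
  rescell (U B) f (vid B).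

Definition conj_lift (A B : X) (f : ver A B) (W0 W1 : X) (rs : path X W0 W1)
    (h : ver W0 B) (k : ver W1 A) (v : ver W1 B) (ev : v = f ∘ k)
    (α : cell rs (U B) h v) : cell rs (conj f) h k :=
  lift (@rescell_cart X _ _ _ _ (U B) f (vid B)) (eq_sym (vidl h)) ev α.

(* The cell (B(g,1)) => B(f,1) corresponding to a 2-cell ξ : f => g: its composite
   with B(f,1) => U_B is B(g,1) => U_B pasted with ξ on the right. *)
Definition conj_map (A B : X) (f g : ver A B) (ξ : cell2 f g) :
    cell ⟦conj g⟧ (conj f) (vid B) (vid A) :=
  conj_lift (v := f) (eq_sym (vidr f))
    (vcast (vidl (vid B)) (vidl f)
      (ccomp2 (umult B) (conj_cell g)
         (vcast (vidr g) (vidr f) (ccomp1 ξ (ucell A))))).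

(* The cell exhibiting C(gf,1) as the composite of C(g,1) and B(f,1). *)
Definition conj_comp (A B C : X) (g : ver B C) (f : ver A B) :
    cell ⟦conj g; conj f⟧ (conj (g ∘ f)) (vid C) (vid A) :=
  conj_lift (v := g ∘ f) (eq_sym (vidr (g ∘ f)))
    (vcast (vidl (vid C)) (vidl (g ∘ f))
      (ccomp2 (umult C) (conj_cell g)
         (vcast (vidr g) eq_refl (ccomp1 (Uver g) (conj_cell f))))).

(* The cell exhibiting C(gf,1) as the restriction C(g,1)(f,1), i.e. the isomorphism
   between them followed by the cartesian cell of the latter. *)
Definition conj_res (A B C : X) (g : ver B C) (f : ver A B) :
    cell ⟦conj (g ∘ f)⟧ (conj g) (vid C) f :=
  conj_lift eq_refl (conj_cell (g ∘ f)).

End Vertical.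

Section Algebras.
Context {X : vequipment} (T : vmonad X) (HT : normal_functor T).

(* T(U_A) => U_(TA) and its inverse: both are units of TA as T is normal. *)
Definition TU (A : X) : cell ⟦fhor T (U A)⟧ (U (T A)) (vid (T A)) (vid (T A)) :=
  oplift (HT (@ucell_opcart X A)) (rs := hnil (T A)) (ss := hnil (T A)) (ucell (T A)).

Definition TU_inv (A : X) : cell ⟦U (T A)⟧ (fhor T (U A)) (vid (T A)) (vid (T A)) :=
  ulift (vcast (fver_id T A) (fver_id T A) (fcell T (ucell A))).

Definition T2 (A B : X) (f g : ver A B) (ξ : cell2 f g) :
    cell2 (fver T f) (fver T g) :=
  vcast (eq_trans (vidl _) (vidr _)) (eq_trans (vidl _) (vidr _))
    (ccomp1 (TU B) (ccomp1 (fcell T ξ : cell ⟦_⟧ _ _ _) (TU_inv A))).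

Lemma assoc_nat_eq (A B C D E : X) (a : ver D E) (f : ver C D) (g : ver B C)
  (f' : ver A D) (g' : ver B A) : f ∘ g = f' ∘ g' -> (a ∘ f) ∘ g = (a ∘ f') ∘ g'.
Proof. now intros e; rewrite <- !vassoc, e. Qed.

Lemma assoc_fver_eq (A B C D : X) (a : ver (T C) D) (f : ver B C) (g : ver A B) :
  (a ∘ fver T f) ∘ fver T g = a ∘ fver T (f ∘ g).
Proof. now rewrite fver_comp, vassoc. Qed.

(* The three axioms are equations between 2-cells whose boundaries agree only up
   to naturality of η and μ and the monad laws, whence [≡]. *)
Record oplax_algebra (A : X) := OplaxAlgebra {
  alg : ver (T A) A;
  abar : cell2 (alg ∘ μ T A) (alg ∘ fver T alg);
  ahat : cell2 (alg ∘ η T A) (vid A);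
  oplax_assoc :
    comp2 (whisk_r abar (fver T (fver T alg)))
          (assoc_nat_eq alg (eq_sym (tver_nat (μ T) alg)))
          (whisk_r abar (μ T (T A)))
    ≡ comp2 (whisk_l alg (T2 abar))
            (assoc_fver_eq alg alg (μ T A))
            (whisk_r abar (fver T (μ T A)));
  oplax_unit_l :
    comp2 (whisk_r ahat alg)
          (assoc_nat_eq alg (eq_sym (tver_nat (η T) alg)))
          (whisk_r abar (η T (T A)))
    ≡ id2 alg;
  oplax_unit_r :
    comp2 (whisk_l alg (T2 ahat))
          (assoc_fver_eq alg alg (η T A))
          (whisk_r abar (fver T (η T A)))
    ≡ id2 alg }.

Definition oplax_normal (A : X) (a : oplax_algebra A) : Prop := iso2 (ahat a).

Record tmonoid_data (A : X) := TMonoidData {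
  tm_hor : hor A (T A);
  tm_mul : cell ⟦tm_hor; fhor T tm_hor⟧ tm_hor (vid A) (μ T A);
  tm_unit : cell (hnil A) tm_hor (vid A) (η T A) }.

(* The monoid axioms in the horizontal Kleisli virtual double category of T: there
   the cells in position i of a source string lie i times under T, and composites
   are corrected by the components of μ (for m) and of η (for e). *)
Definition is_tmonoid (A : X) (M : tmonoid_data A) : Prop :=
  let m := tm_mul M in
  let e := tm_unit M in
  (ccomp2 m (cid (tm_hor M)) (vcast (fver_id T A) eq_refl (fcell T m))
     ≡ ccomp2 m m (tcell (μ T) (tm_hor M)))
  /\ (ccomp2 m e (tcell (η T) (tm_hor M)) ≡ cid (tm_hor M))
  /\ (ccomp2 m (cid (tm_hor M)) (vcast (fver_id T A) eq_refl (fcell T e))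
     ≡ cid (tm_hor M)).

Definition tm_normalized (A : X) (M : tmonoid_data A) : Prop :=
  cartesian (ulift (tm_unit M)).

Definition tm_iso (A : X) (M N : tmonoid_data A) : Prop :=
  exists (φ : cell ⟦tm_hor M⟧ (tm_hor N) (vid A) (vid (T A)))
         (ψ : cell ⟦tm_hor N⟧ (tm_hor M) (vid A) (vid (T A))),
    hinverse φ ψ
    /\ (ccomp1 φ (tm_mul M)
         ≡ ccomp2 (tm_mul N) φ (vcast (fver_id T A) eq_refl (fcell T φ)))
    /\ (ccomp1 φ (tm_unit M) ≡ tm_unit N).

(* The isomorphism between T(B(f,1)) and (TB)(Tf,1). *)
Definition T_conj (A B : X) (f : ver A B) :
    cell ⟦fhor T (conj f)⟧ (conj (fver T f)) (vid (T B)) (vid (T A)) :=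
  conj_lift (v := fver T f) (eq_sym (vidr (fver T f)))
    (vcast (eq_trans (vidl _) (fver_id T B)) (vidl _)
      (ccomp1 (TU B) (fcell T (conj_cell f) : cell ⟦_⟧ _ _ _))).

Definition arising_unit (A : X) (a : oplax_algebra A) :
    cell (hnil A) (conj (alg a)) (vid A) (η T A) :=
  conj_lift (v := alg a ∘ η T A) eq_refl
    (vcast (vidl _) (vidr _) (ccomp1 (ahat a) (ucell A))).

Definition arising_mul (A : X) (a : oplax_algebra A) :
    cell ⟦conj (alg a); fhor T (conj (alg a))⟧ (conj (alg a)) (vid A) (μ T A) :=
  vcast (eq_trans (vidl _) (eq_trans (vidl _) (vidl _)))
        (eq_trans (f_equal (vcomp _) (eq_trans (vidl _) (vidl _))) (vidr _))
    (ccomp1 (conj_res (alg a) (μ T A))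
      (ccomp1 (conj_map (abar a))
        (ccomp2 (conj_comp (alg a) (fver T (alg a)))
           (cid (conj (alg a))) (T_conj (alg a))))).

Definition arising_tmonoid (A : X) (a : oplax_algebra A) : tmonoid_data A :=
  TMonoidData (arising_mul a) (arising_unit a).

End Algebras.

(* Main.v *)
(* A 2-cell ξ : f => g is determined by its composite with the unit cell, a
   nullary cell () => U_B over (g, f), and cells into U_B with matching inner
   boundaries can be juxtaposed by means of U_B, U_B => U_B; this operation ⋆ is
   associative and unital, and vertical composition of 2-cells becomes ⋆.
   Let c : M => U_A over (1, a) be cartesian, and put a·α for the composite of
   Tα with T(U_A) => U_(TA) and U_a.  Cells into M are determined by their
   composites with c.  A unit e and a multiplication m of M with
     c e = â   and   c m = c ⋆ a·c ⋆ ā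
   turn each monoid axiom for M into c ⋆ .. ⋆ ζ = c ⋆ .. ⋆ ζ', where ζ = ζ' is the
   corresponding oplax algebra axiom; the prefix cancels because c has a right
   inverse () => M over (a, 1).  Every pair (e, m) is of this form for unique â
   and ā, since the triangle identity of the conjoint splits c and a·c off any
   cell (M, TM) => U_A.  Finally c e, seen as a cell U_A => U_A, is â, and such a
   cell over (1, f) is cartesian if and only if it is invertible. *)

From Stdlib Require Import ClassicalEpsilon.
Require Import Defs.

Set Implicit Arguments.
Unset Strict Implicit.
Unset Printing Implicit Defensive.

(** * Cells up to equality of their boundaries *)

Section HeterogeneousEquality.
Context {X : vdc_data}.

Lemma cast_irrel (X0 X1 Y0 Y1 : X) (ps ps' : path X X0 X1)
    (q : hor Y0 Y1) (f f' : ver X0 Y0) (g g' : ver X1 Y1)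
    (ep ep' : ps = ps') (ef ef' : f = f') (eg eg' : g = g') (α : cell ps q f g) :
  cast ep ef eg α = cast ep' ef' eg' α.
Proof.
now rewrite (proof_irrelevance _ ep ep'), (proof_irrelevance _ ef ef'),
  (proof_irrelevance _ eg eg').
Qed.

(** By proof irrelevance a cast along loops is the identity, so [≡] loses nothing between cells of
    the same type. *)
Lemma ceq_eq (X0 X1 Y0 Y1 : X) (ps : path X X0 X1) (q : hor Y0 Y1)
    (f : ver X0 Y0) (g : ver X1 Y1) (α β : cell ps q f g) : α ≡ β -> α = β.
Proof.
intros [ep [ef [eg <-]]].
now rewrite (cast_irrel ep eq_refl ef eq_refl eg eq_refl).
Qed.

Lemma ceq_refl (X0 X1 Y0 Y1 : X) (ps : path X X0 X1) (q : hor Y0 Y1)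
    (f : ver X0 Y0) (g : ver X1 Y1) (α : cell ps q f g) : α ≡ α.
Proof. now exists eq_refl, eq_refl, eq_refl. Qed.

Section Laws.
Context {X0 X1 Y0 Y1 : X} {ps ps' ps'' : path X X0 X1} {q : hor Y0 Y1}
  {f f' f'' : ver X0 Y0} {g g' g'' : ver X1 Y1}.

Lemma ceq_sym (α : cell ps q f g) (β : cell ps' q f' g') : α ≡ β -> β ≡ α.
Proof. intros [ep [ef [eg <-]]]. destruct ep, ef, eg. apply ceq_refl. Qed.

Lemma ceq_trans (α : cell ps q f g) (β : cell ps' q f' g') (γ : cell ps'' q f'' g'') :
  α ≡ β -> β ≡ γ -> α ≡ γ.
Proof.
intros [ep [ef [eg <-]]]. destruct ep, ef, eg. exact (fun H => H).
Qed.

Lemma ceq_cast (α : cell ps q f g) (ep : ps = ps') (ef : f = f') (eg : g = g') :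
  cast ep ef eg α ≡ α.
Proof. destruct ep, ef, eg. apply ceq_refl. Qed.

End Laws.

(** Both outer cells have the same source string, so the equality of sources hidden in [≡] is a loop
    and [αs] can stay fixed. The congruence rules for short composites reduce to this one. *)
Lemma ccomp_l (X0 X1 Y0 Y1 Z0 Z1 : X) (qs : path X Y0 Y1) (r : hor Z0 Z1)
    (g0 g0' : ver Y0 Z0) (g1 g1' : ver Y1 Z1) (f0 : ver X0 Y0) (f1 : ver X1 Y1)
    (β : cell qs r g0 g1) (β' : cell qs r g0' g1') (αs : cells X qs f0 f1) :
  β ≡ β' -> ccomp β αs ≡ ccomp β' αs.
Proof.
intros [ep [ef [eg <-]]].
rewrite (proof_irrelevance _ ep eq_refl); destruct ef, eg. apply ceq_refl.
Qed.

Lemma ccomp0_congr (Z Y Y0 Y1 : X) (r : hor Y0 Y1) (g0 g0' : ver Y Y0)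
    (g1 g1' : ver Y Y1) (β : cell (hnil Y) r g0 g1) (β' : cell (hnil Y) r g0' g1')
    (f f' : ver Z Y) :
  β ≡ β' -> f = f' -> ccomp0 β f ≡ ccomp0 β' f'.
Proof. intros H <-. exact (ccomp_l (csnil _ f) H). Qed.

Lemma ccomp1_congr (X0 X1 Y0 Y1 Z0 Z1 : X) (ps ps' : path X X0 X1) (q : hor Y0 Y1)
    (r : hor Z0 Z1) (g0 g0' : ver Y0 Z0) (g1 g1' : ver Y1 Z1)
    (f0 f0' : ver X0 Y0) (f1 f1' : ver X1 Y1)
    (β : cell ⟦q⟧ r g0 g1) (β' : cell ⟦q⟧ r g0' g1')
    (α : cell ps q f0 f1) (α' : cell ps' q f0' f1') :
  β ≡ β' -> α ≡ α' -> ccomp1 β α ≡ ccomp1 β' α'.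
Proof.
intros Hβ [ep [ef [eg <-]]]. destruct ep, ef, eg.
exact (ccomp_l (cscons α (csnil _ f1)) Hβ).
Qed.

Lemma ccomp2_congr (X0 X1 X2 Y0 Y1 Y2 Z0 Z1 : X) (ps ps' : path X X0 X1)
    (rs rs' : path X X1 X2) (q : hor Y0 Y1) (q' : hor Y1 Y2) (r : hor Z0 Z1)
    (g0 g0' : ver Y0 Z0) (g2 g2' : ver Y2 Z1)
    (f0 f0' : ver X0 Y0) (f1 f1' : ver X1 Y1) (f2 f2' : ver X2 Y2)
    (γ : cell ⟦q; q'⟧ r g0 g2) (γ' : cell ⟦q; q'⟧ r g0' g2')
    (α : cell ps q f0 f1) (α' : cell ps' q f0' f1')
    (β : cell rs q' f1 f2) (β' : cell rs' q' f1' f2') :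
  γ ≡ γ' -> α ≡ α' -> β ≡ β' -> ccomp2 γ α β ≡ ccomp2 γ' α' β'.
Proof.
intros Hγ [ep [ef [eg <-]]] [ep' [ef' [eg' <-]]].
destruct ep, ef, eg, ep', eg'.
(* The middle boundary is equated twice, once by each inner cell; the second equation has become a
   loop. *)
rewrite (proof_irrelevance _ ef' eq_refl).
exact (ccomp_l (cscons α (cscons β (csnil _ f2))) Hγ).
Qed.

Lemma fcell_congr (Y : vdc_data) (F : functor_data X Y) (X0 X1 Y0 Y1 : X)
    (ps ps' : path X X0 X1) (q : hor Y0 Y1) (f f' : ver X0 Y0) (g g' : ver X1 Y1)
    (α : cell ps q f g) (α' : cell ps' q f' g') :
  α ≡ α' -> fcell F α ≡ fcell F α'.
Proof.
intros [ep [ef [eg <-]]]. destruct ep, ef, eg. now exists eq_refl, eq_refl, eq_refl.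
Qed.

Lemma happ_nil (X0 X1 : X) (ps : path X X0 X1) : happ ps (hnil X1) = ps.
Proof. induction ps; simpl; congruence. Qed.

(** The target string is an index of the type and [happ qs (hnil _)] is only provably [qs], hence an
    equality of dependent pairs. *)
Lemma cs_app_nil (X0 X1 Y0 Y1 : X) (qs : path X Y0 Y1) (f : ver X0 Y0)
    (g : ver X1 Y1) (αs : cells X qs f g) :
  existT (fun qs => cells X qs f g) _ (cs_app αs (csnil _ g)) = existT _ qs αs.
Proof.
induction αs as [|X0 X1 X2 Y0 Y1 Y2 ps q qs f0 f1 f2 α αs IH]; [reflexivity|].
exact (f_equal (fun s => existT (fun qs => cells X qs f0 f2) _
  (cscons α (projT2 s))) IH).
Qed.

Lemma ccomp_src (X0 X1 Y0 Y1 Z0 Z1 : X) (qs qs' : path X Y0 Y1) (r : hor Z0 Z1)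
    (g0 g0' : ver Y0 Z0) (g1 g1' : ver Y1 Z1) (f0 : ver X0 Y0) (f1 : ver X1 Y1)
    (β : cell qs r g0 g1) (β' : cell qs' r g0' g1') (αs : cells X qs f0 f1)
    (αs' : cells X qs' f0 f1) :
  β ≡ β' -> existT (fun qs => cells X qs f0 f1) _ αs = existT _ qs' αs' ->
  ccomp β αs ≡ ccomp β' αs'.
Proof.
intros [ep [ef [eg <-]]] e. destruct ep, ef, eg.
pose proof (projT2_eq e) as e'. simpl in e'.
rewrite (proof_irrelevance _ (projT1_eq e) eq_refl) in e'. simpl in e'.
rewrite e'. apply ceq_refl.
Qed.

End HeterogeneousEquality.

Ltac vsimp := repeat rewrite ?vidl, ?vidr, ?vassoc, ?fver_id, ?fver_comp.
Ltac ver := solve [ reflexivity | vsimp; reflexivity ].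

Ltac uncast_l := eapply ceq_trans; [apply ceq_cast|].
Ltac uncast_r := eapply ceq_trans; [|apply ceq_sym, ceq_cast].

(** * Associativity for short strings, and uniqueness of factorizations *)

Section Vdc.
Context {X : vdc}.

(** This and the next three lemmas are the associativity law at explicit two-level strings, for
    which [ct_outer], [ct_inner] and [ct_comp] compute. *)
Lemma ccomp1_assoc0 (A B B0 B1 C0 C1 : X) (q : hor B0 B1) (r : hor C0 C1)
    (g0 : ver B0 C0) (g1 : ver B1 C1) (f0 : ver B B0) (f1 : ver B B1)
    (γ : cell ⟦q⟧ r g0 g1) (β : cell (hnil B) q f0 f1) (k : ver A B) :
  ccomp0 (ccomp1 γ β) k ≡ ccomp1 γ (ccomp0 β k).
Proof.
exact (ccomp_assoc γ (ctcons β (csnil _ k) (ctnil k f1))).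
Qed.

Lemma ccomp1_assoc1 (A0 A1 B0 B1 C0 C1 D0 D1 : X) (ps : path X A0 A1)
    (p : hor B0 B1) (q : hor C0 C1) (r : hor D0 D1)
    (h0 : ver C0 D0) (h1 : ver C1 D1) (g0 : ver B0 C0) (g1 : ver B1 C1)
    (f0 : ver A0 B0) (f1 : ver A1 B1)
    (γ : cell ⟦q⟧ r h0 h1) (β : cell ⟦p⟧ q g0 g1) (α : cell ps p f0 f1) :
  ccomp1 (ccomp1 γ β) α ≡ ccomp1 γ (ccomp1 β α).
Proof.
exact (ccomp_assoc γ (ctcons β (cscons α (csnil _ f1)) (ctnil f1 g1))).
Qed.

Lemma ccomp1_assoc2 (A0 A1 A2 B0 B1 B2 C0 C1 D0 D1 : X) (ps : path X A0 A1)
    (ps' : path X A1 A2) (p : hor B0 B1) (p' : hor B1 B2) (q : hor C0 C1) (r : hor D0 D1)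
    (h0 : ver C0 D0) (h1 : ver C1 D1) (g0 : ver B0 C0) (g2 : ver B2 C1)
    (f0 : ver A0 B0) (f1 : ver A1 B1) (f2 : ver A2 B2)
    (γ : cell ⟦q⟧ r h0 h1) (β : cell ⟦p; p'⟧ q g0 g2)
    (α : cell ps p f0 f1) (α' : cell ps' p' f1 f2) :
  ccomp2 (ccomp1 γ β) α α' ≡ ccomp1 γ (ccomp2 β α α').
Proof.
exact (ccomp_assoc γ (ctcons β (cscons α (cscons α' (csnil _ f2))) (ctnil f2 g2))).
Qed.

Lemma ccomp2_assoc (A0 A1 A2 B0 B1 B2 C0 C1 C2 D0 D1 : X) (ps : path X B0 B1)
    (ps' : path X B1 B2) (q : hor C0 C1) (q' : hor C1 C2) (r : hor D0 D1)
    (h0 : ver C0 D0) (h2 : ver C2 D1) (g0 : ver B0 C0) (g1 : ver B1 C1)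
    (g2 : ver B2 C2) (f0 : ver A0 B0) (f1 : ver A1 B1) (f2 : ver A2 B2)
    (γ : cell ⟦q; q'⟧ r h0 h2) (β : cell ps q g0 g1) (β' : cell ps' q' g1 g2)
    (αs : cells X ps f0 f1) (αs' : cells X ps' f1 f2) :
  ccomp (ccomp2 γ β β') (cs_app αs (cs_app αs' (csnil _ f2)))
  ≡ ccomp2 γ (ccomp β αs) (ccomp β' αs').
Proof.
exact (ccomp_assoc γ (ctcons β αs (ctcons β' αs' (ctnil f2 g2)))).
Qed.

(** The uniqueness half of opcartesianness, for a nullary [γ] at the left end of a string. Most
    equations between cells out of units are proved by it: they are compared after the unit has been
    filled in. *)
Lemma opcartesian_inj (A B Z0 Z1 : X) (E : hor A A)
    (γ : cell (hnil A) E (vid A) (vid A)) (ss : path X A B) (t : hor Z0 Z1)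
    (f f' : ver A Z0) (g g' : ver B Z1)
    (δ : cell (E :-: ss) t f g) (δ' : cell (E :-: ss) t f' g') :
  opcartesian γ -> f = f' -> g = g' ->
  ccomp δ (cscons γ (cs_id ss)) ≡ ccomp δ' (cscons γ (cs_id ss)) -> δ ≡ δ'.
Proof.
intros Hγ <- <- H.
assert (Hs : cs_src (cscons γ (cs_id ss)) = ss).
{ simpl. clear. induction ss; simpl; congruence. }
pose (α := cast Hs (vidr f) (vidr g) (ccomp δ' (cscons γ (cs_id ss)))).
destruct (Hγ A B Z0 Z1 (hnil A) ss t f g α) as [ε [_ Hu]].
assert (δ = δ') as ->; [|apply ceq_refl].
transitivity ε; [symmetry|]; apply Hu; simpl.
- eapply ceq_trans; [exact H|]. apply ceq_sym, ceq_cast.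
- apply ceq_sym, ceq_cast.
Qed.

Lemma cartesian_inj (A0 A1 B0 B1 W0 W1 : X) (p : hor A0 A1) (q : hor B0 B1)
    (f : ver A0 B0) (g : ver A1 B1) (κ : cell ⟦p⟧ q f g) (rs rs' : path X W0 W1)
    (h h' : ver W0 A0) (k k' : ver W1 A1) (α : cell rs p h k) (α' : cell rs' p h' k') :
  cartesian κ -> rs = rs' -> h = h' -> k = k' -> ccomp1 κ α ≡ ccomp1 κ α' -> α ≡ α'.
Proof.
intros Hκ <- <- <- H.
destruct (Hκ W0 W1 rs h k (cast (happ_nil rs) eq_refl eq_refl (ccomp1 κ α')))
  as [ε [_ Hu]].
assert (α = α') as ->; [|apply ceq_refl].
transitivity ε; [symmetry|]; apply Hu.
- eapply ceq_trans; [exact H|]. apply ceq_sym, ceq_cast.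
- apply ceq_sym, ceq_cast.
Qed.

Lemma the_spec (A : Type) (P : A -> Prop) (H : exists! x, P x) : P (the H).
Proof. unfold the. apply proj2_sig. Qed.

Lemma oplift_spec (X0 X1 : X) (ps : path X X0 X1) (q : hor X0 X1)
    (γ : cell ps q (vid X0) (vid X1)) (Hγ : opcartesian γ)
    (W0 W1 Z0 Z1 : X) (rs : path X W0 X0) (ss : path X X1 W1) (t : hor Z0 Z1)
    (f : ver W0 Z0) (g : ver W1 Z1) (α : cell (happ rs (happ ps ss)) t f g) :
  ccomp (oplift Hγ α) (cs_app (cs_id rs) (cscons γ (cs_id ss))) ≡ α.
Proof. exact (the_spec (Hγ _ _ _ _ rs ss t f g α)). Qed.

Lemma lift_spec (A0 A1 B0 B1 W0 W1 : X) (p : hor A0 A1) (q : hor B0 B1)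
    (f : ver A0 B0) (g : ver A1 B1) (κ : cell ⟦p⟧ q f g) (Hκ : cartesian κ)
    (rs : path X W0 W1) (h : ver W0 A0) (k : ver W1 A1) (u : ver W0 B0) (v : ver W1 B1)
    (eu : u = f ∘ h) (ev : v = g ∘ k) (α : cell rs q u v) :
  ccomp1 κ (lift Hκ eu ev α) ≡ α.
Proof.
unfold lift. eapply ceq_trans; [apply the_spec|]. apply ceq_cast.
Qed.

End Vdc.

(** * Cells into units *)

Section Packing.
Context {X : vdc_data}.

(* Forgetting the source and the boundaries in the type turns [≡] into [=]. *)
Definition pcell (W0 W1 Y0 Y1 : X) (q : hor Y0 Y1) : Type :=
  {t : path X W0 W1 * ver W0 Y0 * ver W1 Y1 & cell (fst (fst t)) q (snd (fst t)) (snd t)}.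

(** The [option] is there from the start so that the partial operation [pstar] below stays within
    one type; a packed cell itself is never [None]. *)
Definition pk (W0 W1 Y0 Y1 : X) (ps : path X W0 W1) (q : hor Y0 Y1) (f : ver W0 Y0)
    (g : ver W1 Y1) (α : cell ps q f g) : option (pcell W0 W1 q) :=
  Some (existT _ (ps, f, g) α).

Lemma pk_eq (W0 W1 Y0 Y1 : X) (ps ps' : path X W0 W1) (q : hor Y0 Y1)
    (f f' : ver W0 Y0) (g g' : ver W1 Y1) (α : cell ps q f g) (β : cell ps' q f' g') :
  α ≡ β -> pk α = pk β.
Proof. intros [ep [ef [eg <-]]]. now destruct ep, ef, eg. Qed.

Lemma pk_inj (W0 W1 Y0 Y1 : X) (ps ps' : path X W0 W1) (q : hor Y0 Y1)
    (f f' : ver W0 Y0) (g g' : ver W1 Y1) (α : cell ps q f g) (β : cell ps' q f' g') :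
  pk α = pk β -> α ≡ β.
Proof.
intros H.
(* Transporting reflexivity along the equation avoids inverting an equality of dependent pairs. *)
pose (P (x : option (pcell W0 W1 q)) :=
  match x with Some (existT _ t γ) => α ≡ γ | None => True end).
change (P (pk β)). rewrite <- H. apply ceq_refl.
Qed.

End Packing.

Notation "⟪ α ⟫" := (pk α) (at level 0) : vdc_scope.

Section UnitCells.
Context {X : vequipment}.

Lemma ulift_spec (A Y0 Y1 : X) (q : hor Y0 Y1) (f : ver A Y0) (g : ver A Y1)
    (α : cell (hnil A) q f g) : ccomp1 (ulift α) (ucell A) ≡ α.
Proof. exact (oplift_spec (@ucell_opcart X A) (rs := hnil A) (ss := hnil A) α). Qed.

Lemma ucell_inj (A Z0 Z1 : X) (t : hor Z0 Z1)
    (f f' : ver A Z0) (g g' : ver A Z1)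
    (δ : cell ⟦U A⟧ t f g) (δ' : cell ⟦U A⟧ t f' g') :
  f = f' -> g = g' -> ccomp1 δ (ucell A) ≡ ccomp1 δ' (ucell A) -> δ ≡ δ'.
Proof. intros ef eg. exact (opcartesian_inj (ss := hnil A) (@ucell_opcart X A) ef eg). Qed.

Lemma ucell_inj2 (A B Z0 Z1 : X) (p : hor A B) (t : hor Z0 Z1)
    (f f' : ver A Z0) (g g' : ver B Z1)
    (δ : cell ⟦U A; p⟧ t f g) (δ' : cell ⟦U A; p⟧ t f' g') :
  f = f' -> g = g' -> ccomp2 δ (ucell A) (cid p) ≡ ccomp2 δ' (ucell A) (cid p) -> δ ≡ δ'.
Proof. intros ef eg. exact (opcartesian_inj (ss := ⟦p⟧) (@ucell_opcart X A) ef eg). Qed.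

(** The nullary form of a 2-cell; it determines the 2-cell because [U A] is a unit. *)
Definition nul (A B : X) (f g : ver A B) (ξ : cell2 f g) : cell (hnil A) (U B) g f :=
  vcast (vidr g) (vidr f) (ccomp1 ξ (ucell A)).

(** The identity 2-cell of [f] in nullary form, which is the unit for juxtaposition at the boundary
    [f]. *)
Definition un (A B : X) (f : ver A B) : cell (hnil A) (U B) f f :=
  vcast (vidl f) (vidl f) (ccomp0 (ucell B) f).

Lemma nul_spec (A B : X) (f g : ver A B) (ξ : cell2 f g) :
  nul ξ ≡ ccomp1 ξ (ucell A).
Proof. apply ceq_cast. Qed.

Lemma un_spec (A B : X) (f : ver A B) : un f ≡ ccomp0 (ucell B) f.
Proof. apply ceq_cast. Qed.

Lemma nul_inj (A B : X) (f g f' g' : ver A B) (ξ : cell2 f g) (ξ' : cell2 f' g') :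
  f = f' -> g = g' -> nul ξ ≡ nul ξ' -> ξ ≡ ξ'.
Proof.
intros ef eg H. apply ucell_inj; auto.
eapply ceq_trans; [apply ceq_sym, nul_spec|].
eapply ceq_trans; [exact H|apply nul_spec].
Qed.

Lemma nul_congr (A B : X) (f g f' g' : ver A B) (ξ : cell2 f g) (ξ' : cell2 f' g') :
  ξ ≡ ξ' -> nul ξ ≡ nul ξ'.
Proof.
intros H. uncast_l. uncast_r. apply ccomp1_congr; [exact H|apply ceq_refl].
Qed.

Lemma nul_ulift (A B : X) (f g : ver A B) (α : cell (hnil A) (U B) g f) :
  nul (ulift α : cell2 f g) ≡ α.
Proof. eapply ceq_trans; [apply nul_spec|apply ulift_spec]. Qed.

Lemma nul_Uver (A B : X) (f : ver A B) : nul (Uver f : cell2 f f) ≡ un f.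
Proof. apply nul_ulift. Qed.

Lemma umult_ucell (B : X) : ccomp2 (umult B) (ucell B) (cid (U B)) ≡ cid (U B).
Proof.
exact (oplift_spec (@ucell_opcart X B) (rs := hnil B) (ss := ⟦U B⟧) (cid (U B))).
Qed.

(** The inner boundaries are allowed to agree only up to an equation [e], because later they agree
    by naturality or by a monad law. The outer cast removes the identities and the empty string that
    composition leaves behind. *)
Definition star (W0 W1 W2 B : X) (ps : path X W0 W1) (qs : path X W1 W2)
    (f : ver W0 B) (g g' : ver W1 B) (h : ver W2 B)
    (α : cell ps (U B) f g) (e : g = g') (β : cell qs (U B) g' h) :
    cell (happ ps qs) (U B) f h :=
  cast (f_equal (happ ps) (happ_nil qs)) (vidl f) (vidl h)
    (ccomp2 (umult B) α (vcast (eq_sym e) eq_refl β)).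

Lemma star_spec (W0 W1 W2 B : X) (ps : path X W0 W1) (qs : path X W1 W2)
    (f : ver W0 B) (g g' : ver W1 B) (h : ver W2 B)
    (α : cell ps (U B) f g) (e : g = g') (β : cell qs (U B) g' h)
    (β' : cell qs (U B) g h) :
  β' ≡ β -> star α e β ≡ ccomp2 (umult B) α β'.
Proof.
intros H. uncast_l. apply ccomp2_congr; try apply ceq_refl.
uncast_l. now apply ceq_sym.
Qed.

Lemma star_congr (W0 W1 W2 B : X) (ps ps' : path X W0 W1) (qs qs' : path X W1 W2)
    (f f' : ver W0 B) (g1 g1' g2 g2' : ver W1 B) (h h' : ver W2 B)
    (α : cell ps (U B) f g1) (e : g1 = g2) (β : cell qs (U B) g2 h)
    (α' : cell ps' (U B) f' g1') (e' : g1' = g2') (β' : cell qs' (U B) g2' h') :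
  α ≡ α' -> β ≡ β' -> star α e β ≡ star α' e' β'.
Proof.
intros H H'. uncast_l. uncast_r. apply ccomp2_congr; [apply ceq_refl|exact H|].
uncast_l. uncast_r. exact H'.
Qed.

(** This is associativity of composition with [umult] as the outer cell; the trailing empty string
    of the binary composite is removed by [cs_app_nil]. *)
Lemma star_ccomp (W0 W1 W2 V0 V1 V2 B : X) (ps : path X W0 W1) (qs : path X W1 W2)
    (f : ver W0 B) (g g' : ver W1 B) (h : ver W2 B) (k0 : ver V0 W0) (k1 : ver V1 W1)
    (k2 : ver V2 W2)
    (α : cell ps (U B) f g) (e : g = g') (β : cell qs (U B) g' h)
    (αs : cells X ps k0 k1) (βs : cells X qs k1 k2) :
  ccomp (star α e β) (cs_app αs βs)
  ≡ star (ccomp α αs) (f_equal (fun u => u ∘ k1) e) (ccomp β βs).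
Proof.
destruct e. simpl.
eapply ceq_trans.
2:{ apply ceq_sym, star_spec, ceq_refl. }
eapply ceq_trans; [|apply ccomp2_assoc].
apply ccomp_src; [apply star_spec, ceq_refl|].
exact (f_equal (fun s => existT (fun rs => cells X rs k0 k2) (happ ps (projT1 s))
  (cs_app αs (projT2 s))) (eq_sym (cs_app_nil βs))).
Qed.

(** The defining equation of [umult], precomposed with [f] in the unit slot and [α] in the other. *)
Lemma un_star (W0 W1 B : X) (ps : path X W0 W1) (f f' : ver W0 B) (g : ver W1 B)
    (e : f = f') (α : cell ps (U B) f' g) : star (un f) e α ≡ α.
Proof.
destruct e. eapply ceq_trans; [apply star_spec, ceq_refl|].
eapply ceq_trans; [|apply ccomp_idl].
eapply ceq_trans; [|apply ccomp1_congr; [apply umult_ucell|apply ceq_refl]].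
apply ceq_sym.
eapply ceq_trans.
{ exact (ccomp2_assoc (umult B) (ucell B) (cid (U B)) (csnil _ f) (cscons α (csnil _ g))). }
apply ccomp2_congr; [apply ceq_refl|apply ceq_sym, un_spec|apply ccomp_idl].
Qed.

(** [umult] is defined by its left unit law only. The right one follows by filling the remaining
    slot with the unit cell too: both sides become the unit cell, by the left law. *)
Lemma umult_ucell_r (B : X) : ccomp2 (umult B) (cid (U B)) (ucell B) ≡ cid (U B).
Proof.
apply ucell_inj; try ver.
eapply ceq_trans.
{ exact (ccomp2_assoc (umult B) (cid (U B)) (ucell B)
    (cscons (ucell B) (csnil _ _)) (csnil _ 𝟙)). }
eapply ceq_trans.
{ apply ccomp2_congr with (α' := ucell B) (β' := ucell B);
    [apply ceq_refl|apply ccomp_idl|apply (ccomp_idr (ucell B))]. }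
apply ceq_sym.
eapply ceq_trans; [apply ccomp_idl|].
apply ceq_sym.
eapply ceq_trans; [apply ceq_sym, star_spec with (e := eq_refl), ceq_refl|].
eapply ceq_trans; [|apply un_star with (e := eq_refl)].
apply star_congr; [|apply ceq_refl].
apply ceq_sym. eapply ceq_trans; [apply un_spec|apply (ccomp_idr (ucell B))].
Qed.

Lemma star_un (W0 W1 B : X) (ps : path X W0 W1) (f : ver W0 B) (g g' : ver W1 B)
    (e : g = g') (α : cell ps (U B) f g) : star α e (un g') ≡ α.
Proof.
destruct e. eapply ceq_trans; [apply star_spec, ceq_refl|].
eapply ceq_trans; [|apply ccomp_idl].
eapply ceq_trans; [|apply ccomp1_congr; [apply umult_ucell_r|apply ceq_refl]].
apply ceq_sym.
eapply ceq_trans.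
{ exact (ccomp2_assoc (umult B) (cid (U B)) (ucell B) (cscons α (csnil _ g))
    (csnil _ g)). }
apply ccomp2_congr; [apply ceq_refl|apply ccomp_idl|apply ceq_sym, un_spec].
Qed.

(** With the unit cell in the first of the three slots both sides reduce to [umult]. *)
Lemma umult_assoc (B : X) :
  ccomp2 (umult B) (umult B) (cid (U B)) ≡ ccomp2 (umult B) (cid (U B)) (umult B).
Proof.
pose proof (umult_ucell B) as Hu.
assert (Hi : forall (C D : X) (p : hor C D), ccomp1 (cid p) (cid p) ≡ cid p)
  by (intros; apply ccomp_idl).
apply (opcartesian_inj (ss := ⟦U B; U B⟧) (@ucell_opcart X B)); try ver.
eapply ceq_trans.
{ exact (ccomp2_assoc (umult B) (umult B) (cid (U B))
    (cscons (ucell B) (cscons (cid (U B)) (csnil _ _)))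
    (cscons (cid (U B)) (csnil _ _))). }
apply ceq_sym. eapply ceq_trans.
{ exact (ccomp2_assoc (umult B) (cid (U B)) (umult B)
    (cscons (ucell B) (csnil _ _))
    (cscons (cid (U B)) (cscons (cid (U B)) (csnil _ _)))). }
eapply ceq_trans.
{ apply ccomp2_congr with (α' := ucell B) (β' := umult B);
    [apply ceq_refl|apply ccomp_idl|apply (ccomp_idr (umult B))]. }
apply ceq_sym. eapply ceq_trans.
{ apply ccomp2_congr with (α' := cid (U B)) (β' := cid (U B));
    [apply ceq_refl|exact Hu|apply Hi]. }
eapply ceq_trans; [apply (ccomp_idr (umult B))|].
apply ceq_sym.
eapply ceq_trans; [apply ceq_sym, star_spec with (e := eq_refl), ceq_refl|].
eapply ceq_trans; [|apply un_star with (e := eq_refl)].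
apply star_congr; [|apply ceq_refl].
apply ceq_sym. eapply ceq_trans; [apply un_spec|apply (ccomp_idr (ucell B))].
Qed.

Lemma star_assoc (W0 W1 W2 W3 B : X) (ps : path X W0 W1) (qs : path X W1 W2)
    (rs : path X W2 W3) (f : ver W0 B) (g g' : ver W1 B) (h h' : ver W2 B)
    (k : ver W3 B) (α : cell ps (U B) f g) (e : g = g') (β : cell qs (U B) g' h)
    (e' : h = h') (γ : cell rs (U B) h' k) :
  star (star α e β) e' γ ≡ star α e (star β e' γ).
Proof.
destruct e, e'.
(* The factor that stands alone on either side is padded with an identity cell; then both sides are
   instances of [umult_assoc] precomposed with the string of [α], [β], [γ]. *)
assert (H : star (ccomp2 (umult B) α β) eq_refl (ccomp1 (cid (U B)) γ)
  ≡ star (ccomp1 (cid (U B)) α) eq_refl (ccomp2 (umult B) β γ)).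
{ eapply ceq_trans; [apply star_spec, ceq_refl|].
  apply ceq_sym. eapply ceq_trans; [apply star_spec, ceq_refl|]. apply ceq_sym.
  eapply ceq_trans.
  { apply ceq_sym.
    exact (ccomp2_assoc (umult B) (umult B) (cid (U B))
      (cscons α (cscons β (csnil _ _))) (cscons γ (csnil _ _))). }
  apply ceq_sym. eapply ceq_trans.
  { apply ceq_sym.
    exact (ccomp2_assoc (umult B) (cid (U B)) (umult B)
      (cscons α (csnil _ _)) (cscons β (cscons γ (csnil _ _)))). }
  apply ceq_sym. apply ccomp_l, umult_assoc. }
eapply ceq_trans; [|eapply ceq_trans; [exact H|]]; apply star_congr.
- apply star_spec, ceq_refl.
- apply ceq_sym, ccomp_idl.
- apply ccomp_idl.
- apply ceq_sym, star_spec, ceq_refl.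
Qed.
End UnitCells.

(** * Juxtaposition as a partial operation *)

(** The middle object is hidden in a string, so the tail is read off as a dependent pair, and proof
    irrelevance removes the resulting loop at that object. *)
Lemma hcons_inj (O : Type) (H : O -> O -> Type) (A B C : O) (p : H A B)
    (ps ps' : hpath H B C) : hcons p ps = hcons p ps' -> ps = ps'.
Proof.
intros e.
pose (tl := fun (Y Z : O) (qs : hpath H Y Z) =>
  match qs in hpath _ _ Z return option {W & hpath H W Z} with
  | hnil _ => None
  | hcons _ qs' => Some (existT _ _ qs')
  end).
pose proof (f_equal (tl A C) e) as e1. simpl in e1.
injection e1 as e2. pose proof (projT2_eq e2) as e3. simpl in e3.
now rewrite (proof_irrelevance _ (projT1_eq e2) eq_refl) in e3.
Qed.

(* Juxtaposition of cells into [U B], undefined ([None]) unless the inner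
   boundaries agree; this makes associativity hold unconditionally. *)
Definition pstar (X : vequipment) (W0 W1 W2 B : X) (x : option (pcell W0 W1 (U B)))
    (y : option (pcell W1 W2 (U B))) : option (pcell W0 W2 (U B)) :=
  match x, y with
  | Some (existT _ (_, _, g) α), Some (existT _ (_, g', _) β) =>
      match excluded_middle_informative (g = g') with
      | left e => pk (star α e β)
      | right _ => None
      end
  | _, _ => None
  end.

Notation "x ⋆ y" := (pstar x y) (at level 41, right associativity) : vdc_scope.

Section PackedStar.
Context {X : vequipment}.

Lemma pk_star (W0 W1 W2 B : X) (ps : path X W0 W1) (qs : path X W1 W2)
    (f : ver W0 B) (g g' : ver W1 B) (h : ver W2 B)
    (α : cell ps (U B) f g) (e : g = g') (β : cell qs (U B) g' h) :
  ⟪star α e β⟫ = ⟪α⟫ ⋆ ⟪β⟫.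
Proof.
simpl. destruct (excluded_middle_informative (g = g')) as [e'|n]; [|contradiction].
now rewrite (proof_irrelevance _ e e').
Qed.

Lemma pstar_defined (W0 W1 W2 B : X) (ps : path X W0 W1) (qs : path X W1 W2)
    (f : ver W0 B) (g g' : ver W1 B) (h : ver W2 B)
    (α : cell ps (U B) f g) (β : cell qs (U B) g' h) :
  ⟪α⟫ ⋆ ⟪β⟫ <> None -> g = g'.
Proof. simpl. now destruct (excluded_middle_informative (g = g')). Qed.

Lemma pstar_defined_r (W0 W1 W2 B : X) (x : option (pcell W0 W1 (U B)))
    (y : option (pcell W1 W2 (U B))) : x ⋆ y <> None -> y <> None.
Proof. destruct x as [[[[? ?] ?] ?]|], y as [[[[? ?] ?] ?]|]; simpl; congruence. Qed.

Lemma pstar_assoc (W0 W1 W2 W3 B : X) (x : option (pcell W0 W1 (U B)))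
    (y : option (pcell W1 W2 (U B))) (z : option (pcell W2 W3 (U B))) :
  (x ⋆ y) ⋆ z = x ⋆ y ⋆ z.
Proof.
destruct x as [[[[ps f] g] α]|]; [|reflexivity].
destruct y as [[[[qs g'] h] β]|]; [|reflexivity].
destruct z as [[[[rs h'] k] γ]|].
2:{ simpl. destruct (excluded_middle_informative (g = g')); reflexivity. }
simpl in *.
change ((⟪α⟫ ⋆ ⟪β⟫) ⋆ ⟪γ⟫ = ⟪α⟫ ⋆ ⟪β⟫ ⋆ ⟪γ⟫).
destruct (excluded_middle_informative (g = g')) as [e|n];
destruct (excluded_middle_informative (h = h')) as [e'|n'].
- rewrite <- (pk_star α e β), <- (pk_star β e' γ), <- (pk_star _ e' γ), <- (pk_star α e).
  apply pk_eq, star_assoc.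
- rewrite <- (pk_star α e β). simpl.
  now destruct (excluded_middle_informative (h = h')).
- rewrite <- (pk_star β e' γ). simpl.
  now destruct (excluded_middle_informative (g = g')).
- simpl. destruct (excluded_middle_informative (g = g')); [contradiction|].
  now destruct (excluded_middle_informative (h = h')).
Qed.

Lemma pk_un_star (W0 W1 B : X) (ps : path X W0 W1) (f f' : ver W0 B) (g : ver W1 B)
    (α : cell ps (U B) f' g) : f = f' -> ⟪un f⟫ ⋆ ⟪α⟫ = ⟪α⟫.
Proof. intros e. rewrite <- (pk_star _ e). apply pk_eq, un_star. Qed.

Lemma pk_star_un (W0 W1 B : X) (ps : path X W0 W1) (f : ver W0 B) (g g' : ver W1 B)
    (α : cell ps (U B) f g) : g = g' -> ⟪α⟫ ⋆ ⟪un g'⟫ = ⟪α⟫.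
Proof. intros e. rewrite <- (pk_star _ e). apply pk_eq, star_un. Qed.

(** The packed form of [star_ccomp]. No matching of inner boundaries is assumed: a packed cell is
    not [None], so the equation for [γ] already forces the juxtaposition to be defined. *)
Lemma pk_ccomp (W0 W1 W2 V0 V1 V2 B : X) (ps : path X W0 W1) (qs : path X W1 W2)
    (f f' : ver W0 B) (g g' : ver W1 B) (h h' : ver W2 B)
    (k0 : ver V0 W0) (k1 : ver V1 W1) (k2 : ver V2 W2)
    (γ : cell (happ ps qs) (U B) f' h')
    (α : cell ps (U B) f g) (β : cell qs (U B) g' h)
    (αs : cells X ps k0 k1) (βs : cells X qs k1 k2) :
  ⟪γ⟫ = ⟪α⟫ ⋆ ⟪β⟫ -> ⟪ccomp γ (cs_app αs βs)⟫ = ⟪ccomp α αs⟫ ⋆ ⟪ccomp β βs⟫.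
Proof.
intros H.
assert (e : g = g') by (apply (pstar_defined (α := α) (β := β)); now rewrite <- H).
rewrite <- (pk_star α e β) in H.
rewrite <- (pk_star _ (f_equal (fun u => u ∘ k1) e)).
apply pk_eq. eapply ceq_trans; [|apply star_ccomp].
apply ccomp_l, pk_inj, H.
Qed.

(** Precomposing the factor [α] with its right inverse [δ] turns it into a unit for juxtaposition
    and leaves the other factor. Definedness is assumed because an equation between two undefined
    products carries no information. *)
Lemma pstar_cancel (W0 W1 W2 B : X) (p : hor W0 W1) (f : ver W0 B) (g : ver W1 B)
    (k : ver W1 W0) (α : cell ⟦p⟧ (U B) f g) (δ : cell (hnil W1) p k (vid W1))
    (z z' : option (pcell W1 W2 (U B))) :
  ⟪ccomp1 α δ⟫ = ⟪un g⟫ -> ⟪α⟫ ⋆ z <> None -> ⟪α⟫ ⋆ z = ⟪α⟫ ⋆ z' -> z = z'.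
Proof.
intros Hδ D H.
assert (D' : ⟪α⟫ ⋆ z' <> None) by now rewrite <- H.
destruct z as [[[[qs g1] h] β]|]; [|now destruct D].
destruct z' as [[[[qs' g1'] h'] β']|]; [|now destruct D'].
simpl in β, β'.
change (⟪α⟫ ⋆ ⟪β⟫ <> None) in D. change (⟪α⟫ ⋆ ⟪β'⟫ <> None) in D'.
change (⟪α⟫ ⋆ ⟪β⟫ = ⟪α⟫ ⋆ ⟪β'⟫) in H. change (⟪β⟫ = ⟪β'⟫).
assert (E : forall (qs : path X W1 W2) (g1 : ver W1 B) (h : ver W2 B)
  (β : cell qs (U B) g1 h) (e : g = g1),
  ccomp (star α e β) (cscons δ (cs_id qs)) ≡ β).
{ clear - Hδ. intros.
  eapply ceq_trans.
  { exact (star_ccomp α e β (cscons δ (csnil _ _)) (cs_id qs)). }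
  apply pk_inj. rewrite pk_star.
  etransitivity; [exact (f_equal (fun x => x ⋆ _) Hδ)|].
  rewrite pk_un_star by (now rewrite vidr).
  apply pk_eq, ccomp_idr. }
pose proof (pstar_defined D) as e. pose proof (pstar_defined D') as e'.
rewrite <- (pk_star α e), <- (pk_star α e') in H. apply pk_inj in H.
apply pk_eq. eapply ceq_trans; [apply ceq_sym, (E _ _ _ β e)|].
eapply ceq_trans; [|apply (E _ _ _ β' e')].
(* The two juxtapositions have equal source strings with the same head [p], so the tails agree and
   one string of cells can be composed with both. *)
assert (qs = qs') as <- by (destruct H as [ep _]; exact (hcons_inj ep)).
now apply ccomp_l.
Qed.
End PackedStar.

(** * Interchange and the action of the monad *)

Section Interchange.
Context {X : vequipment}.

Lemma pk_ccomp1 (V0 V1 W0 W1 B : X) (ps : path X V0 V1) (p : hor W0 W1)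
    (f f' : ver W0 B) (g g' h h' : ver W1 B) (k0 : ver V0 W0) (k1 : ver V1 W1)
    (γ : cell ⟦p⟧ (U B) f' h') (α : cell ⟦p⟧ (U B) f g) (β : cell (hnil W1) (U B) g' h)
    (x : cell ps p k0 k1) :
  ⟪γ⟫ = ⟪α⟫ ⋆ ⟪β⟫ -> ⟪ccomp1 γ x⟫ = ⟪ccomp1 α x⟫ ⋆ ⟪ccomp0 β k1⟫.
Proof.
intros H.
exact (pk_ccomp (ps := ⟦p⟧) (qs := hnil W1) (cscons x (csnil _ k1)) (csnil _ k1) H).
Qed.

Lemma pk_ccomp2 (V0 V1 V2 W0 W1 W2 B : X) (ps : path X V0 V1) (qs : path X V1 V2)
    (p : hor W0 W1) (q : hor W1 W2) (f f' : ver W0 B) (g g' : ver W1 B) (h h' : ver W2 B)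
    (k0 : ver V0 W0) (k1 : ver V1 W1) (k2 : ver V2 W2)
    (γ : cell ⟦p; q⟧ (U B) f' h') (α : cell ⟦p⟧ (U B) f g) (β : cell ⟦q⟧ (U B) g' h)
    (x : cell ps p k0 k1) (y : cell qs q k1 k2) :
  ⟪γ⟫ = ⟪α⟫ ⋆ ⟪β⟫ -> ⟪ccomp2 γ x y⟫ = ⟪ccomp1 α x⟫ ⋆ ⟪ccomp1 β y⟫.
Proof.
intros H.
exact (pk_ccomp (ps := ⟦p⟧) (qs := ⟦q⟧) (cscons x (csnil _ k1))
  (cscons y (csnil _ k2)) H).
Qed.

Lemma pk_ccomp2_tail (V0 V1 V2 W0 W1 W2 B : X) (ps : path X V0 V1) (qs : path X V1 V2)
    (p : hor W0 W1) (q : hor W1 W2) (f f' : ver W0 B) (g g' : ver W1 B)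
    (h h' l l' : ver W2 B)
    (k0 : ver V0 W0) (k1 : ver V1 W1) (k2 : ver V2 W2)
    (γ : cell ⟦p; q⟧ (U B) f' l') (α : cell ⟦p⟧ (U B) f g) (β : cell ⟦q⟧ (U B) g' h)
    (δ : cell (hnil W2) (U B) h' l) (x : cell ps p k0 k1) (y : cell qs q k1 k2) :
  ⟪γ⟫ = ⟪α⟫ ⋆ ⟪β⟫ ⋆ ⟪δ⟫ ->
  ⟪ccomp2 γ x y⟫ = ⟪ccomp1 α x⟫ ⋆ ⟪ccomp1 β y⟫ ⋆ ⟪ccomp0 δ k2⟫.
Proof.
intros H.
assert (e : h = h').
{ apply (pstar_defined (α := β) (β := δ)), (pstar_defined_r (x := ⟪α⟫)).
  now rewrite <- H. }
rewrite <- (pk_star β e δ) in H.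
etransitivity; [exact (pk_ccomp2 x y H)|]. f_equal.
exact (pk_ccomp1 y (pk_star β e δ)).
Qed.

(** With the unit cell in the first slot both sides become [ξ], since [Uver g] on the unit cell is
    [un g]. *)
Lemma umult_whisk_l (A B : X) (f g : ver A B) (ξ : cell2 f g) :
  ccomp1 ξ (umult A) ≡ ccomp2 (umult B) (Uver g) ξ.
Proof.
apply ucell_inj2; try ver.
eapply ceq_trans; [apply ccomp1_assoc2|].
eapply ceq_trans; [apply ccomp1_congr; [apply ceq_refl|apply umult_ucell]|].
eapply ceq_trans; [exact (ccomp_idr ξ)|].
apply ceq_sym. eapply ceq_trans.
{ exact (ccomp2_assoc (umult B) (Uver g) ξ (cscons (ucell A) (csnil _ _))
    (cscons (cid (U A)) (csnil _ _))). }
eapply ceq_trans; [apply ceq_sym, star_spec with (e := eq_refl), ceq_refl|].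
apply pk_inj. rewrite pk_star.
rewrite (pk_eq (α := ccomp (Uver g) _) (β := un g)) by exact (ulift_spec _).
rewrite pk_un_star by ver. apply pk_eq, (ccomp_idr ξ).
Qed.

Lemma nul_whisk (A B : X) (f g : ver A B) (ξ : cell2 f g) :
  ⟪nul ξ⟫ ⋆ ⟪Uver f⟫ = ⟪ξ⟫.
Proof.
rewrite <- (pk_star (nul ξ) eq_refl (Uver f)). apply pk_eq.
apply ucell_inj; try ver. apply pk_inj.
assert (H : ⟪star (nul ξ) eq_refl (Uver f)⟫ = ⟪nul ξ⟫ ⋆ ⟪Uver f⟫) by apply pk_star.
etransitivity.
{ exact (pk_ccomp (ps := hnil A) (qs := ⟦U A⟧) (csnil _ 𝟙)
    (cscons (ucell A) (csnil _ 𝟙)) H). }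
rewrite (pk_eq (α := ccomp (Uver f) _) (β := un f)) by exact (ulift_spec _).
rewrite pk_star_un by ver.
apply pk_eq. eapply ceq_trans; [exact (ccomp_idr (nul ξ))|apply nul_spec].
Qed.

Lemma pk_whisk_l (A B W0 W1 W2 : X) (ps : path X W0 W1) (qs : path X W1 W2)
    (rs : path X W0 W2) (f g : ver A B) (ξ : cell2 f g) (h h' : ver W0 A)
    (k k' : ver W1 A) (l l' : ver W2 A) (γ : cell rs (U A) h' l')
    (α : cell ps (U A) h k) (β : cell qs (U A) k' l) :
  ⟪γ⟫ = ⟪α⟫ ⋆ ⟪β⟫ -> ⟪ccomp1 ξ γ⟫ = ⟪ccomp1 (Uver g) α⟫ ⋆ ⟪ccomp1 ξ β⟫.
Proof.
intros H.
assert (e : k = k') by (apply (pstar_defined (α := α) (β := β)); now rewrite <- H).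
destruct e. rewrite <- (pk_star α eq_refl β) in H.
rewrite <- (pk_star _ eq_refl). apply pk_eq.
eapply ceq_trans; [|apply ceq_sym, star_spec, ceq_refl].
eapply ceq_trans; [apply ccomp1_congr; [apply ceq_refl|exact (pk_inj H)]|].
eapply ceq_trans.
{ apply ccomp1_congr; [apply ceq_refl|apply star_spec, ceq_refl]. }
eapply ceq_trans; [apply ceq_sym, ccomp1_assoc2|].
eapply ceq_trans.
{ apply ccomp2_congr; [apply umult_whisk_l|apply ceq_refl..]. }
exact (ccomp2_assoc (umult B) (Uver g) ξ (cscons α (csnil _ _)) (cscons β (csnil _ _))).
Qed.

Lemma ccomp1_un (A B C : X) (f g : ver A B) (ξ : cell2 f g) (k : ver C A) :
  ccomp1 ξ (un k) ≡ ccomp0 (nul ξ) k.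
Proof.
eapply ceq_trans; [apply ccomp1_congr; [apply ceq_refl|apply un_spec]|].
eapply ceq_trans; [apply ceq_sym, ccomp1_assoc0|].
apply ccomp0_congr; [apply ceq_sym, nul_spec|reflexivity].
Qed.

(** Obtained by splitting [α] as [α ⋆ un k]. Together with [cell2_nul_l], which splits [ξ] as
    [nul ξ ⋆ Uver f], it is the interchange law: a 2-cell can be moved from the left to the right of
    a cell into a unit. *)
Lemma cell2_nul_r (A B W0 W1 : X) (f g : ver A B) (ξ : cell2 f g)
    (ps : path X W0 W1) (h : ver W0 A) (k : ver W1 A) (α : cell ps (U A) h k) :
  ⟪ccomp1 ξ α⟫ = ⟪ccomp1 (Uver g) α⟫ ⋆ ⟪ccomp0 (nul ξ) k⟫.
Proof.
etransitivity.
{ apply (pk_whisk_l ξ (α := α) (β := un k)). symmetry. now apply pk_star_un. }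
f_equal. apply pk_eq, ccomp1_un.
Qed.

Lemma cell2_nul_l (A B W0 W1 : X) (f g : ver A B) (ξ : cell2 f g)
    (ps : path X W0 W1) (h : ver W0 A) (k : ver W1 A) (α : cell ps (U A) h k) :
  ⟪ccomp1 ξ α⟫ = ⟪ccomp0 (nul ξ) h⟫ ⋆ ⟪ccomp1 (Uver f) α⟫.
Proof.
exact (pk_ccomp (ps := hnil A) (qs := ⟦U A⟧) (csnil _ h) (cscons α (csnil _ k))
  (eq_sym (nul_whisk ξ))).
Qed.

Lemma Uver_un (A B C : X) (g : ver B C) (f : ver A B) :
  ccomp1 (Uver g) (un f) ≡ un (g ∘ f).
Proof.
eapply ceq_trans; [apply ccomp1_un|].
eapply ceq_trans; [apply ccomp0_congr; [apply nul_Uver|reflexivity]|].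
apply ceq_sym. eapply ceq_trans; [apply un_spec|]. apply ceq_sym.
eapply ceq_trans; [apply ccomp0_congr; [apply un_spec|reflexivity]|].
eapply ceq_trans; [apply (ccomp_assoc (ucell C) (ctnil f g))|].
apply ceq_refl.
Qed.

Lemma Uver_ucell (A B : X) (f : ver A B) : ccomp1 (Uver f) (ucell A) ≡ un f.
Proof. apply ulift_spec. Qed.

Lemma Uver_comp (A B C : X) (g : ver B C) (f : ver A B) :
  ccomp1 (Uver g) (Uver f) ≡ Uver (g ∘ f).
Proof.
apply ucell_inj; try ver.
eapply ceq_trans; [apply ccomp1_assoc1|].
eapply ceq_trans; [apply ccomp1_congr; [apply ceq_refl|apply Uver_ucell]|].
eapply ceq_trans; [apply Uver_un|]. apply ceq_sym, Uver_ucell.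
Qed.

Lemma Uver_ccomp1 (A B C W0 W1 : X) (g : ver B C) (f : ver A B) (ps : path X W0 W1)
    (h : ver W0 A) (k : ver W1 A) (α : cell ps (U A) h k) :
  ccomp1 (Uver g) (ccomp1 (Uver f) α) ≡ ccomp1 (Uver (g ∘ f)) α.
Proof.
eapply ceq_trans; [apply ceq_sym, ccomp1_assoc1|].
apply ccomp1_congr; [apply Uver_comp|apply ceq_refl].
Qed.

Lemma Uver_vid (B : X) : Uver (vid B) ≡ cid (U B).
Proof.
apply ucell_inj; try reflexivity.
eapply ceq_trans; [apply Uver_ucell|].
eapply ceq_trans; [apply un_spec|].
eapply ceq_trans; [exact (ccomp_idr (ucell B))|].
apply ceq_sym, ccomp_idl.
Qed.

Lemma Uver_vid_ccomp1 (B W0 W1 : X) (ps : path X W0 W1) (h : ver W0 B) (k : ver W1 B)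
    (α : cell ps (U B) h k) : ccomp1 (Uver 𝟙) α ≡ α.
Proof.
eapply ceq_trans; [|apply ccomp_idl].
apply ccomp1_congr; [apply Uver_vid|apply ceq_refl].
Qed.

Lemma ccomp0_vid (A Y0 Y1 : X) (q : hor Y0 Y1) (f : ver A Y0) (g : ver A Y1)
    (α : cell (hnil A) q f g) : ccomp0 α 𝟙 ≡ α.
Proof. exact (ccomp_idr α). Qed.

Lemma ccomp0_un (A B C : X) (f : ver B C) (k : ver A B) : ccomp0 (un f) k ≡ un (f ∘ k).
Proof.
eapply ceq_trans; [|apply Uver_un].
eapply ceq_trans; [|apply ceq_sym, ccomp1_un].
apply ccomp0_congr; [apply ceq_sym, nul_Uver|reflexivity].
Qed.

Lemma pk_cast (W0 W1 Y0 Y1 : X) (ps ps' : path X W0 W1) (q : hor Y0 Y1)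
    (f f' : ver W0 Y0) (g g' : ver W1 Y1) (ep : ps = ps') (ef : f = f') (eg : g = g')
    (α : cell ps q f g) : ⟪cast ep ef eg α⟫ = ⟪α⟫.
Proof. apply pk_eq, ceq_cast. Qed.

Lemma pk_umult (W0 W1 W2 B : X) (ps : path X W0 W1) (qs : path X W1 W2)
    (f : ver W0 B) (g : ver W1 B) (h : ver W2 B)
    (α : cell ps (U B) f g) (β : cell qs (U B) g h) :
  ⟪ccomp2 (umult B) α β⟫ = ⟪α⟫ ⋆ ⟪β⟫.
Proof.
rewrite <- (pk_star α eq_refl β). apply pk_eq, ceq_sym, star_spec, ceq_refl.
Qed.

(** The reversal of boundaries in [cell2] is what keeps the factors in the same order. *)
Lemma nul_comp2 (A B : X) (f g g' h : ver A B) (ζ : cell2 g' h) (e : g = g')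
    (ξ : cell2 f g) : ⟪nul (comp2 ζ e ξ)⟫ = ⟪nul ζ⟫ ⋆ ⟪nul ξ⟫.
Proof.
etransitivity; [exact (pk_eq (nul_ulift _))|]. rewrite pk_cast.
etransitivity; [exact (pk_umult _ _)|]. rewrite pk_cast.
now rewrite (pk_eq (nul_spec ζ)), (pk_eq (nul_spec ξ)).
Qed.

Lemma nul_whisk_r (A B C : X) (f g : ver A B) (ξ : cell2 f g) (k : ver C A) :
  nul (whisk_r ξ k) ≡ ccomp0 (nul ξ) k.
Proof.
eapply ceq_trans; [apply nul_spec|].
eapply ceq_trans; [apply ccomp1_assoc1|].
eapply ceq_trans; [|apply ccomp1_un].
apply ccomp1_congr; [apply ceq_refl|apply Uver_ucell].
Qed.

Lemma nul_whisk_l (A B C : X) (h : ver B C) (f g : ver A B) (ξ : cell2 f g) :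
  nul (whisk_l h ξ) ≡ ccomp1 (Uver h) (nul ξ).
Proof.
eapply ceq_trans; [apply nul_spec|].
eapply ceq_trans; [apply ccomp1_assoc1|].
apply ccomp1_congr; [apply ceq_refl|apply ceq_sym, nul_spec].
Qed.

End Interchange.

(** * The monad acting on cells into units *)

Section FunctorAction.
Context {X : vequipment} (T : vmonad X) (HT : normal_functor T).

Notation T1 α := (fcell T α : cell ⟦_⟧ _ _ _).

Lemma fcell_ccomp0 (A B C0 C1 : X) (r : hor C0 C1) (g0 : ver B C0) (g1 : ver B C1)
    (β : cell (hnil B) r g0 g1) (f : ver A B) :
  fcell T (ccomp0 β f) ≡ ccomp0 (fcell T β : cell (hnil _) _ _ _) (fver T f).
Proof. exact (fcell_comp T β (csnil _ f)). Qed.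

Lemma fcell_ccomp1 (A0 A1 B0 B1 C0 C1 : X) (ps : path X A0 A1) (q : hor B0 B1)
    (r : hor C0 C1) (g0 : ver B0 C0) (g1 : ver B1 C1) (f0 : ver A0 B0) (f1 : ver A1 B1)
    (β : cell ⟦q⟧ r g0 g1) (α : cell ps q f0 f1) :
  fcell T (ccomp1 β α) ≡ ccomp1 (T1 β) (fcell T α).
Proof. exact (fcell_comp T β (cscons α (csnil _ f1))). Qed.

Lemma fcell_ccomp2 (A0 A1 A2 B0 B1 B2 C0 C1 : X) (ps : path X A0 A1) (qs : path X A1 A2)
    (p : hor B0 B1) (q : hor B1 B2) (r : hor C0 C1) (g0 : ver B0 C0) (g2 : ver B2 C1)
    (f0 : ver A0 B0) (f1 : ver A1 B1) (f2 : ver A2 B2)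
    (γ : cell ⟦p; q⟧ r g0 g2) (α : cell ps p f0 f1) (β : cell qs q f1 f2) :
  fcell T (ccomp2 γ α β)
  ≡ ccomp2 (fcell T γ : cell ⟦_; _⟧ _ _ _) (fcell T α) (fcell T β).
Proof. exact (fcell_comp T γ (cscons α (cscons β (csnil _ f2)))). Qed.

(** The image of a unit cell, with boundaries corrected to identities; normality makes it
    opcartesian, so cells out of [fhor T (U A)] can be compared on it. *)
Definition Tucell (A : X) : cell (hnil (T A)) (fhor T (U A)) (vid (T A)) (vid (T A)) :=
  vcast (fver_id T A) (fver_id T A) (fcell T (ucell A)).

Lemma Tucell_opcart (A : X) : opcartesian (Tucell A).
Proof. exact (HT (@ucell_opcart X A)). Qed.

Lemma Tucell_spec (A : X) : Tucell A ≡ fcell T (ucell A).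
Proof. apply ceq_cast. Qed.

Lemma Tucell_inj (A Z0 Z1 : X) (t : hor Z0 Z1)
    (f f' : ver (T A) Z0) (g g' : ver (T A) Z1)
    (δ : cell ⟦fhor T (U A)⟧ t f g) (δ' : cell ⟦fhor T (U A)⟧ t f' g') :
  f = f' -> g = g' -> ccomp1 δ (Tucell A) ≡ ccomp1 δ' (Tucell A) -> δ ≡ δ'.
Proof. intros ef eg. exact (opcartesian_inj (ss := hnil _) (@Tucell_opcart A) ef eg). Qed.

Lemma TU_Tucell (A : X) : ccomp1 (TU HT A) (Tucell A) ≡ ucell (T A).
Proof.
exact (oplift_spec (HT (@ucell_opcart X A)) (rs := hnil (T A)) (ss := hnil (T A))
  (ucell (T A))).
Qed.

(** With [Tucell B] in the first slot both sides reduce to [TU HT B]. *)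
Lemma TU_umult (B : X) :
  ccomp1 (TU HT B) (fcell T (umult B)) ≡ ccomp2 (umult (T B)) (TU HT B) (TU HT B).
Proof.
apply (opcartesian_inj (ss := ⟦fhor T (U B)⟧) (@Tucell_opcart B)); try ver.
change (ccomp2 (ccomp1 (TU HT B) (fcell T (umult B) : cell ⟦_; _⟧ _ _ _))
  (Tucell B) (cid (fhor T (U B)))
  ≡ ccomp2 (ccomp2 (umult (T B)) (TU HT B) (TU HT B)) (Tucell B) (cid (fhor T (U B)))).
eapply ceq_trans; [apply ccomp1_assoc2|].
eapply ceq_trans.
{ apply ccomp1_congr with (α' := cid (fhor T (U B))); [apply ceq_refl|].
  eapply ceq_trans.
  { apply ccomp2_congr; [apply ceq_refl|apply Tucell_spec|apply ceq_sym, fcell_id]. }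
  eapply ceq_trans; [apply ceq_sym, fcell_ccomp2|].
  eapply ceq_trans; [apply fcell_congr, umult_ucell|]. apply fcell_id. }
eapply ceq_trans; [exact (ccomp_idr (TU HT B))|].
apply ceq_sym. eapply ceq_trans.
{ exact (ccomp2_assoc (umult (T B)) (TU HT B) (TU HT B) (cscons (Tucell B) (csnil _ _))
    (cscons (cid (fhor T (U B))) (csnil _ _))). }
apply pk_inj. etransitivity; [exact (pk_umult _ _)|].
rewrite (pk_eq (α := ccomp (TU HT B) (cscons (Tucell B) _)) (β := un 𝟙)).
- rewrite pk_un_star by ver. apply pk_eq. exact (ccomp_idr (TU HT B)).
- eapply ceq_trans; [exact (TU_Tucell B)|].
  apply ceq_sym, (ceq_trans (un_spec _)), ccomp0_vid.
Qed.

Definition That (W0 W1 B : X) (ps : path X W0 W1) (f : ver W0 B) (g : ver W1 B)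
    (α : cell ps (U B) f g) :
    cell (path_map (@fhor X X T) ps) (U (T B)) (fver T f) (fver T g) :=
  cast (happ_nil _) (vidl _) (vidl _) (ccomp1 (TU HT B) (fcell T α)).

Lemma That_spec (W0 W1 B : X) (ps : path X W0 W1) (f : ver W0 B) (g : ver W1 B)
    (α : cell ps (U B) f g) : That α ≡ ccomp1 (TU HT B) (fcell T α).
Proof. apply ceq_cast. Qed.

Lemma That_congr (W0 W1 B : X) (ps ps' : path X W0 W1) (f f' : ver W0 B)
    (g g' : ver W1 B) (α : cell ps (U B) f g) (α' : cell ps' (U B) f' g') :
  α ≡ α' -> That α ≡ That α'.
Proof.
intros H. uncast_l. uncast_r.
apply ccomp1_congr; [apply ceq_refl|now apply fcell_congr].
Qed.

(** A consequence of [TU_umult]; on nullary cells it expresses that the 2-monad respects vertical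
    composition of 2-cells. *)
Lemma pk_That (W0 W1 W2 B : X) (ps : path X W0 W1) (qs : path X W1 W2)
    (rs : path X W0 W2) (f f' : ver W0 B) (g g' : ver W1 B) (h h' : ver W2 B)
    (γ : cell rs (U B) f' h') (α : cell ps (U B) f g) (β : cell qs (U B) g' h) :
  ⟪γ⟫ = ⟪α⟫ ⋆ ⟪β⟫ -> ⟪That γ⟫ = ⟪That α⟫ ⋆ ⟪That β⟫.
Proof.
intros H.
assert (e : g = g') by (apply (pstar_defined (α := α) (β := β)); now rewrite <- H).
destruct e. rewrite <- (pk_umult α β) in H.
rewrite (pk_eq (That_congr (pk_inj H))).
rewrite !(pk_eq (That_spec _)), <- pk_umult. apply pk_eq.
eapply ceq_trans; [apply ccomp1_congr; [apply ceq_refl|apply fcell_ccomp2]|].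
eapply ceq_trans; [apply ceq_sym, ccomp1_assoc2|].
eapply ceq_trans; [apply ccomp2_congr; [apply TU_umult|apply ceq_refl..]|].
exact (ccomp2_assoc (umult (T B)) (TU HT B) (TU HT B) (cscons (fcell T α) (csnil _ _))
    (cscons (fcell T β) (csnil _ _))).
Qed.

Lemma That_ccomp1 (W0 W1 V0 V1 B : X) (p : hor W0 W1) (f : ver W0 B) (g : ver W1 B)
    (α : cell ⟦p⟧ (U B) f g) (ps : path X V0 V1) (h : ver V0 W0) (k : ver V1 W1)
    (x : cell ps p h k) : That (ccomp1 α x) ≡ ccomp1 (That α) (fcell T x).
Proof.
uncast_l. eapply ceq_trans; [apply ccomp1_congr; [apply ceq_refl|apply fcell_ccomp1]|].
eapply ceq_trans; [apply ceq_sym, ccomp1_assoc1|].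
apply ccomp1_congr; [exact (ceq_sym (That_spec α))|apply ceq_refl].
Qed.

Lemma That_un (A B : X) (f : ver A B) : That (un f) ≡ un (fver T f).
Proof.
uncast_l. eapply ceq_trans.
{ apply ccomp1_congr; [apply ceq_refl|].
  eapply ceq_trans; [apply fcell_congr, un_spec|].
  eapply ceq_trans; [apply fcell_ccomp0|].
  apply ccomp0_congr; [apply ceq_sym, Tucell_spec|reflexivity]. }
eapply ceq_trans; [apply ceq_sym, ccomp1_assoc0|].
apply ceq_sym, (ceq_trans (un_spec _)), ccomp0_congr; [|reflexivity].
apply ceq_sym, TU_Tucell.
Qed.

Lemma That_Uver (A B W0 W1 : X) (f : ver A B) (ps : path X W0 W1) (h : ver W0 A)
    (k : ver W1 A) (α : cell ps (U A) h k) :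
  That (ccomp1 (Uver f) α) ≡ ccomp1 (Uver (fver T f)) (That α).
Proof.
assert (H : That (Uver f) ≡ ccomp1 (Uver (fver T f)) (TU HT A)).
{ apply Tucell_inj; try ver.
  eapply ceq_trans; [apply ccomp1_congr; [apply ceq_refl|apply Tucell_spec]|].
  eapply ceq_trans; [apply ceq_sym, That_ccomp1|].
  eapply ceq_trans; [apply That_congr, Uver_ucell|].
  eapply ceq_trans; [apply That_un|].
  apply ceq_sym, (ceq_trans (ccomp1_assoc1 _ _ _)).
  eapply ceq_trans; [apply ccomp1_congr; [apply ceq_refl|apply TU_Tucell]|].
  apply Uver_ucell. }
eapply ceq_trans; [apply That_ccomp1|].
eapply ceq_trans; [apply ccomp1_congr; [exact H|apply ceq_refl]|].
eapply ceq_trans; [apply ccomp1_assoc1|].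
apply ccomp1_congr; [apply ceq_refl|apply ceq_sym, That_spec].
Qed.

(** The factor [TU_inv] of [T2] meets the unit cell and becomes the image of the unit cell, which
    functoriality absorbs into [nul ξ]. *)
Lemma nul_T2 (A B : X) (f g : ver A B) (ξ : cell2 f g) :
  nul (T2 HT ξ) ≡ That (nul ξ).
Proof.
eapply ceq_trans; [apply nul_spec|].
eapply ceq_trans; [apply ccomp1_congr; [apply ceq_cast|apply ceq_refl]|].
eapply ceq_trans; [apply ccomp1_assoc1|].
apply ceq_sym. uncast_l. apply ccomp1_congr; [apply ceq_refl|].
eapply ceq_trans; [apply fcell_congr, nul_spec|].
eapply ceq_trans; [apply fcell_ccomp1|].
apply ceq_sym, (ceq_trans (ccomp1_assoc1 _ _ _)).
apply ccomp1_congr; [apply ceq_refl|].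
eapply ceq_trans; [apply ulift_spec|apply ceq_cast].
Qed.

(** This and the next three lemmas are naturality of [η] and [μ] freed from the casts inside
    [id_functor] and [comp_functor]. *)
Lemma η_ccomp0 (A C0 C1 : X) (q : hor C0 C1) (f : ver A C0) (g : ver A C1)
    (α : cell (hnil A) q f g) :
  ccomp1 (tcell (η T) q) α ≡ ccomp0 (fcell T α : cell (hnil _) _ _ _) (η T A).
Proof.
eapply ceq_trans; [|exact (tcell_nat (η T) α)].
apply ccomp1_congr; [apply ceq_refl|]. apply ceq_sym, ceq_cast.
Qed.

Lemma η_ccomp1 (A0 A1 C0 C1 : X) (p : hor A0 A1) (q : hor C0 C1) (f : ver A0 C0)
    (g : ver A1 C1) (α : cell ⟦p⟧ q f g) :
  ccomp1 (tcell (η T) q) α ≡ ccomp1 (T1 α) (tcell (η T) p).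
Proof.
eapply ceq_trans; [|exact (tcell_nat (η T) α)].
apply ccomp1_congr; [apply ceq_refl|]. apply ceq_sym, ceq_cast.
Qed.

Lemma μ_ccomp0 (A C0 C1 : X) (q : hor C0 C1) (f : ver A C0) (g : ver A C1)
    (α : cell (hnil A) q f g) :
  ccomp1 (tcell (μ T) q) (fcell T (fcell T α))
  ≡ ccomp0 (fcell T α : cell (hnil _) _ _ _) (μ T A).
Proof.
eapply ceq_trans; [|exact (tcell_nat (μ T) α)].
apply ccomp1_congr; [apply ceq_refl|]. apply ceq_sym, ceq_cast.
Qed.

Lemma μ_ccomp1 (A0 A1 C0 C1 : X) (p : hor A0 A1) (q : hor C0 C1) (f : ver A0 C0)
    (g : ver A1 C1) (α : cell ⟦p⟧ q f g) :
  ccomp1 (tcell (μ T) q) (fcell T (fcell T α)) ≡ ccomp1 (T1 α) (tcell (μ T) p).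
Proof.
eapply ceq_trans; [|exact (tcell_nat (μ T) α)].
apply ccomp1_congr; [apply ceq_refl|]. apply ceq_sym, ceq_cast.
Qed.

(** Both sides are determined by their composite with the unit cell, where naturality of [η] at that
    nullary cell applies. *)
Lemma TU_η (B : X) : ccomp1 (TU HT B) (tcell (η T) (U B)) ≡ Uver (η T B).
Proof.
apply ucell_inj; try ver.
eapply ceq_trans; [apply ccomp1_assoc1|].
eapply ceq_trans; [apply ccomp1_congr; [apply ceq_refl|apply η_ccomp0]|].
eapply ceq_trans.
{ apply ccomp1_congr; [apply ceq_refl|].
  apply ccomp0_congr; [apply ceq_sym, Tucell_spec|reflexivity]. }
eapply ceq_trans; [apply ceq_sym, ccomp1_assoc0|].
eapply ceq_trans; [apply ccomp0_congr; [apply TU_Tucell|reflexivity]|].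
apply ceq_sym, (ceq_trans (Uver_ucell _)), un_spec.
Qed.

Lemma That_η (A0 A1 B : X) (p : hor A0 A1) (f : ver A0 B) (g : ver A1 B)
    (α : cell ⟦p⟧ (U B) f g) :
  ccomp1 (That α) (tcell (η T) p) ≡ ccomp1 (Uver (η T B)) α.
Proof.
eapply ceq_trans; [apply ccomp1_congr; [exact (That_spec α)|apply ceq_refl]|].
eapply ceq_trans; [apply ccomp1_assoc1|].
eapply ceq_trans; [apply ccomp1_congr; [apply ceq_refl|apply ceq_sym, η_ccomp1]|].
eapply ceq_trans; [apply ceq_sym, ccomp1_assoc1|].
apply ccomp1_congr; [apply TU_η|apply ceq_refl].
Qed.

Lemma TU_μ (B : X) :
  ccomp1 (TU HT B) (tcell (μ T) (U B)) ≡ ccomp1 (Uver (μ T B)) (That (TU HT B)).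
Proof.
(* By normality, applied twice, the image of the unit cell under the square of [T] is opcartesian,
   so it suffices to compare the two sides on it; both become [un (μ T B)]. *)
pose (γ := vcast (fver_id T (T B)) (fver_id T (T B)) (fcell T (Tucell B))).
assert (Hγ : opcartesian γ) by exact (HT (@Tucell_opcart B)).
assert (Eγ : γ ≡ fcell T (Tucell B)) by apply ceq_cast.
apply (opcartesian_inj (ss := hnil _) Hγ); try ver.
change (ccomp1 (ccomp1 (TU HT B) (tcell (μ T) (U B) : cell ⟦_⟧ _ _ _)) γ
  ≡ ccomp1 (ccomp1 (Uver (μ T B)) (That (TU HT B) : cell ⟦_⟧ _ _ _)) γ).
eapply ceq_trans; [apply ccomp1_assoc1|].
eapply ceq_trans.
{ apply ccomp1_congr; [apply ceq_refl|].
  eapply ceq_trans; [apply ccomp1_congr; [apply ceq_refl|]|].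
  { exact (ceq_trans Eγ (fcell_congr T (Tucell_spec B))). }
  eapply ceq_trans; [apply μ_ccomp0|].
  apply ccomp0_congr; [apply ceq_sym, Tucell_spec|reflexivity]. }
eapply ceq_trans; [apply ceq_sym, ccomp1_assoc0|].
eapply ceq_trans; [apply ccomp0_congr; [apply TU_Tucell|reflexivity]|].
apply ceq_sym, (ceq_trans (ccomp1_assoc1 _ _ _)).
eapply ceq_trans.
{ apply ccomp1_congr; [apply ceq_refl|].
  eapply ceq_trans; [apply ccomp1_congr; [apply ceq_refl|exact Eγ]|].
  eapply ceq_trans; [apply ceq_sym, That_ccomp1|].
  eapply ceq_trans; [apply That_congr, TU_Tucell|].
  eapply ceq_trans; [apply That_spec|].
  eapply ceq_trans; [apply ccomp1_congr; [apply ceq_refl|apply ceq_sym, Tucell_spec]|].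
  apply TU_Tucell. }
eapply ceq_trans; [apply Uver_ucell|apply un_spec].
Qed.

Lemma That_μ (A0 A1 B : X) (p : hor A0 A1) (f : ver A0 B) (g : ver A1 B)
    (α : cell ⟦p⟧ (U B) f g) :
  ccomp1 (That α) (tcell (μ T) p) ≡ ccomp1 (Uver (μ T B)) (That (That α)).
Proof.
eapply ceq_trans; [apply ccomp1_congr; [exact (That_spec α)|apply ceq_refl]|].
eapply ceq_trans; [apply ccomp1_assoc1|].
eapply ceq_trans; [apply ccomp1_congr; [apply ceq_refl|apply ceq_sym, μ_ccomp1]|].
eapply ceq_trans; [apply ceq_sym, ccomp1_assoc1|].
eapply ceq_trans; [apply ccomp1_congr; [apply TU_μ|apply ceq_refl]|].
eapply ceq_trans; [apply ccomp1_assoc1|].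
apply ccomp1_congr; [apply ceq_refl|].
eapply ceq_trans; [apply ceq_sym, That_ccomp1|].
apply That_congr. exact (ceq_sym (That_spec α)).
Qed.

End FunctorAction.

(** * Oplax algebras and monoids in terms of nullary cells *)

Section Arising.
Context {X : vequipment} (T : vmonad X) (HT : normal_functor T).

Lemma conj_lift_spec (A B : X) (f : ver A B) (W0 W1 : X) (rs : path X W0 W1)
    (h : ver W0 B) (k : ver W1 A) (v : ver W1 B) (ev : v = f ∘ k)
    (α : cell rs (U B) h v) : ccomp1 (conj_cell f) (conj_lift ev α) ≡ α.
Proof. apply lift_spec. Qed.

Definition act (A : X) (a : ver (T A) A) (W0 W1 : X) (ps : path X W0 W1)
    (f : ver W0 A) (g : ver W1 A) (α : cell ps (U A) f g) :
    cell (path_map (@fhor X X T) ps) (U A) (a ∘ fver T f) (a ∘ fver T g) :=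
  cast (happ_nil _) eq_refl eq_refl (ccomp1 (Uver a) (That HT α)).

Section Action.
Context {A : X} (a : ver (T A) A).

Lemma act_spec (W0 W1 : X) (ps : path X W0 W1)
    (f : ver W0 A) (g : ver W1 A) (α : cell ps (U A) f g) :
  act a α ≡ ccomp1 (Uver a) (That HT α).
Proof. apply ceq_cast. Qed.

Lemma act_congr (W0 W1 : X) (ps ps' : path X W0 W1) (f f' : ver W0 A)
    (g g' : ver W1 A) (α : cell ps (U A) f g) (α' : cell ps' (U A) f' g') :
  α ≡ α' -> act a α ≡ act a α'.
Proof.
intros H. uncast_l. uncast_r. apply ccomp1_congr; [apply ceq_refl|].
now apply That_congr.
Qed.

Lemma pk_act (W0 W1 W2 : X) (ps : path X W0 W1) (qs : path X W1 W2)
    (rs : path X W0 W2) (f f' : ver W0 A) (g g' : ver W1 A) (h h' : ver W2 A)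
    (γ : cell rs (U A) f' h') (α : cell ps (U A) f g) (β : cell qs (U A) g' h) :
  ⟪γ⟫ = ⟪α⟫ ⋆ ⟪β⟫ -> ⟪act a γ⟫ = ⟪act a α⟫ ⋆ ⟪act a β⟫.
Proof.
intros H. unfold act. rewrite !pk_cast.
exact (pk_whisk_l (Uver a : cell2 a a) (pk_That HT H)).
Qed.

Lemma act_ccomp1 (W0 W1 V0 V1 : X) (p : hor W0 W1) (f : ver W0 A) (g : ver W1 A)
    (α : cell ⟦p⟧ (U A) f g) (ps : path X V0 V1) (h : ver V0 W0) (k : ver V1 W1)
    (x : cell ps p h k) :
  act a (ccomp1 α x) ≡ ccomp1 (act a α : cell ⟦_⟧ _ _ _) (fcell T x).
Proof.
uncast_l. eapply ceq_trans.
{ apply ccomp1_congr; [apply ceq_refl|apply That_ccomp1]. }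
eapply ceq_trans; [apply ceq_sym, ccomp1_assoc1|].
apply ccomp1_congr; [exact (ceq_sym (act_spec α))|apply ceq_refl].
Qed.

Lemma act_un (B : X) (f : ver B A) : act a (un f) ≡ un (a ∘ fver T f).
Proof.
eapply ceq_trans; [apply act_spec|].
eapply ceq_trans; [apply ccomp1_congr; [apply ceq_refl|apply That_un]|].
apply Uver_un.
Qed.

(** Written with [That] twice so that it differs from [act_μ] only in the arrow under [Uver]. These
    two arrows are the boundaries of the algebra's associativity 2-cell, so interchange can pass
    from one expression to the other. *)
Lemma act_act (W0 W1 : X) (ps : path X W0 W1)
    (f : ver W0 A) (g : ver W1 A) (α : cell ps (U A) f g) :
  act a (act a α) ≡ ccomp1 (Uver (a ∘ fver T a)) (That HT (That HT α)).
Proof.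
eapply ceq_trans; [apply act_spec|].
eapply ceq_trans; [|apply Uver_ccomp1].
apply ccomp1_congr; [apply ceq_refl|].
eapply ceq_trans; [apply That_congr, act_spec|]. apply That_Uver.
Qed.

Lemma act_η (W0 W1 : X) (p : hor W0 W1) (f : ver W0 A) (g : ver W1 A)
    (α : cell ⟦p⟧ (U A) f g) :
  ccomp1 (act a α) (tcell (η T) p) ≡ ccomp1 (Uver (a ∘ η T A)) α.
Proof.
eapply ceq_trans; [apply ccomp1_congr; [exact (act_spec α)|apply ceq_refl]|].
eapply ceq_trans; [exact (ccomp1_assoc1 _ (That HT α : cell ⟦_⟧ _ _ _) _)|].
eapply ceq_trans; [apply ccomp1_congr; [apply ceq_refl|apply That_η]|].
apply Uver_ccomp1.
Qed.

Lemma act_μ (W0 W1 : X) (p : hor W0 W1) (f : ver W0 A) (g : ver W1 A)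
    (α : cell ⟦p⟧ (U A) f g) :
  ccomp1 (act a α) (tcell (μ T) p)
  ≡ ccomp1 (Uver (a ∘ μ T A)) (That HT (That HT α)).
Proof.
eapply ceq_trans; [apply ccomp1_congr; [exact (act_spec α)|apply ceq_refl]|].
eapply ceq_trans; [exact (ccomp1_assoc1 _ (That HT α : cell ⟦_⟧ _ _ _) _)|].
eapply ceq_trans; [apply ccomp1_congr; [apply ceq_refl|apply That_μ]|].
apply Uver_ccomp1.
Qed.

End Action.

Lemma arising_unit_spec (A : X) (a : oplax_algebra HT A) :
  ccomp1 (conj_cell (alg a)) (arising_unit a) ≡ nul (ahat a).
Proof.
eapply ceq_trans; [apply conj_lift_spec|].
uncast_l. apply ceq_sym, nul_spec.
Qed.

Lemma conj_res_spec (A B C : X) (g : ver B C) (f : ver A B) :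
  ccomp1 (conj_cell g) (conj_res g f) ≡ conj_cell (g ∘ f).
Proof. apply conj_lift_spec. Qed.

Lemma conj_map_spec (A B : X) (f g : ver A B) (ξ : cell2 f g) :
  ⟪ccomp1 (conj_cell f) (conj_map ξ)⟫ = ⟪conj_cell g⟫ ⋆ ⟪nul ξ⟫.
Proof.
etransitivity; [exact (pk_eq (conj_lift_spec _ _))|]. rewrite pk_cast.
etransitivity; [exact (pk_umult _ _)|]. now rewrite pk_cast, (pk_eq (nul_spec ξ)).
Qed.

Lemma conj_comp_spec (A B C : X) (g : ver B C) (f : ver A B) :
  ⟪ccomp1 (conj_cell (g ∘ f)) (conj_comp g f)⟫
  = ⟪conj_cell g⟫ ⋆ ⟪ccomp1 (Uver g) (conj_cell f)⟫.
Proof.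
etransitivity; [exact (pk_eq (conj_lift_spec _ _))|]. rewrite pk_cast.
etransitivity; [exact (pk_umult _ _)|]. now rewrite pk_cast.
Qed.

Lemma T_conj_spec (A B : X) (f : ver A B) :
  ccomp1 (conj_cell (fver T f)) (T_conj HT f) ≡ That HT (conj_cell f).
Proof.
eapply ceq_trans; [apply conj_lift_spec|].
uncast_l. apply ceq_sym. exact (That_spec HT (conj_cell f)).
Qed.

(** Composing with the cartesian cell of the conjoint peels off the constituents of the
    multiplication: [conj_res] is absorbed, [conj_map] contributes the nullary form of [abar],
    [conj_comp] splits the rest in two, and [T_conj] turns the second part into the action on the
    cartesian cell. *)
Lemma arising_mul_spec (A : X) (a : oplax_algebra HT A) :
  ⟪ccomp1 (conj_cell (alg a)) (arising_mul a)⟫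
  = ⟪conj_cell (alg a)⟫ ⋆ ⟪act (alg a) (conj_cell (alg a))⟫ ⋆ ⟪nul (abar a)⟫.
Proof.
set (c := conj_cell (alg a)).
transitivity ⟪ccomp1 c (ccomp1 (conj_res (alg a) (μ T A))
      (ccomp1 (conj_map (abar a))
        (ccomp2 (conj_comp (alg a) (fver T (alg a)))
           (cid (conj (alg a))) (T_conj HT (alg a)))))⟫.
{ apply pk_eq, ccomp1_congr; [apply ceq_refl|apply ceq_cast]. }
set (z := ccomp2 _ _ _).
transitivity ⟪ccomp1 (ccomp1 (conj_cell (alg a ∘ μ T A)) (conj_map (abar a))) z⟫.
{ apply pk_eq. eapply ceq_trans; [apply ceq_sym, ccomp1_assoc1|].
  eapply ceq_trans; [apply ccomp1_congr; [apply conj_res_spec|apply ceq_refl]|].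
  apply ceq_sym, ccomp1_assoc1. }
etransitivity; [exact (pk_ccomp1 z (conj_map_spec (abar a)))|].
rewrite <- pstar_assoc. apply f_equal2.
2:{ apply pk_eq. eapply ceq_trans; [|apply ccomp0_vid].
    apply ccomp0_congr; [apply ceq_refl|apply vidl]. }
transitivity ⟪ccomp2 (ccomp1 (conj_cell (alg a ∘ fver T (alg a)))
  (conj_comp (alg a) (fver T (alg a)))) (cid (conj (alg a))) (T_conj HT (alg a))⟫.
{ apply pk_eq, ceq_sym, ccomp1_assoc2. }
etransitivity; [exact (pk_ccomp2 _ _ (conj_comp_spec _ _))|]. apply f_equal2.
- apply pk_eq. exact (ccomp_idr c).
- apply pk_eq. eapply ceq_trans; [apply ccomp1_assoc1|].
  eapply ceq_trans; [apply ccomp1_congr; [apply ceq_refl|apply T_conj_spec]|].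
  exact (ceq_sym (act_spec _ c)).
Qed.

End Arising.

(** * Monoid axioms against oplax algebra axioms *)

Section Comparison.
Context {X : vequipment} {T : vmonad X} (HT : normal_functor T) {A : X}
  {a : ver (T A) A} {M : tmonoid_data T A} {c : cell ⟦tm_hor M⟧ (U A) (vid A) a}
  {bar : cell2 (a ∘ μ T A) (a ∘ fver T a)} {hat : cell2 (a ∘ η T A) (vid A)}.
(** The monoid data and the 2-cells are arbitrary and linked only by two equations. Hence the
    equivalences below can be read from algebras to monoids for the first statement of the theorem,
    and from monoids to algebras for the second. *)
Hypothesis Hc : cartesian c.
Hypothesis Hm : ⟪ccomp1 c (tm_mul M)⟫ = ⟪c⟫ ⋆ ⟪act HT a c⟫ ⋆ ⟪nul bar⟫.
Hypothesis He : ccomp1 c (tm_unit M) ≡ nul hat.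

(** This [d] is the unit of the conjoint, a right inverse of [c]. Its images under [T] serve the
    cells [act HT a c] and [act HT a (act HT a c)] in the same way. *)
Lemma cart_unit_ex : exists d : cell (hnil (T A)) (tm_hor M) a (vid (T A)),
  ccomp1 c d ≡ un a.
Proof.
exists (lift Hc (eq_sym (vidl a)) (eq_sym (vidr a)) (un a)). apply lift_spec.
Qed.

Lemma cart_cancel (W : X) (z z' : option (pcell (T A) W (U A))) :
  ⟪c⟫ ⋆ z <> None -> ⟪c⟫ ⋆ z = ⟪c⟫ ⋆ z' -> z = z'.
Proof.
destruct cart_unit_ex as [d Hd]. apply (pstar_cancel (δ := d)), pk_eq, Hd.
Qed.

Lemma act_cancel (W : X) (z z' : option (pcell (T (T A)) W (U A))) :
  ⟪act HT a c⟫ ⋆ z <> None -> ⟪act HT a c⟫ ⋆ z = ⟪act HT a c⟫ ⋆ z' -> z = z'.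
Proof.
destruct cart_unit_ex as [d Hd].
apply (pstar_cancel (p := fhor T (tm_hor M)) (δ := vcast eq_refl (fver_id T _) (fcell T d))).
apply pk_eq.
eapply ceq_trans; [apply ccomp1_congr; [apply ceq_refl|apply ceq_cast]|].
eapply ceq_trans; [apply ceq_sym, act_ccomp1|].
eapply ceq_trans; [apply act_congr, Hd|]. apply act_un.
Qed.

Lemma act_act_cancel (W : X) (z z' : option (pcell (T (T (T A))) W (U A))) :
  ⟪act HT a (act HT a c)⟫ ⋆ z <> None ->
  ⟪act HT a (act HT a c)⟫ ⋆ z = ⟪act HT a (act HT a c)⟫ ⋆ z' -> z = z'.
Proof.
destruct cart_unit_ex as [d Hd].
assert (e : fver T (fver T (vid (T A))) = vid (T (T (T A)))) by ver.
apply (pstar_cancel (p := fhor T (fhor T (tm_hor M)))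
  (δ := vcast eq_refl e (fcell T (fcell T d)))).
apply pk_eq.
eapply ceq_trans; [apply ccomp1_congr; [apply ceq_refl|apply ceq_cast]|].
eapply ceq_trans; [exact (ceq_sym (act_ccomp1 HT a (act HT a c : cell ⟦_⟧ _ _ _) (fcell T d)))|].
eapply ceq_trans; [apply act_congr; exact (ceq_sym (act_ccomp1 HT a c d))|].
eapply ceq_trans; [apply act_congr, act_congr, Hd|].
eapply ceq_trans; [apply act_congr, act_un|]. apply act_un.
Qed.

Lemma pk_cart_mul (V0 V1 V2 : X) (ps : path X V0 V1) (qs : path X V1 V2)
    (k0 : ver V0 A) (k1 : ver V1 (T A)) (k2 : ver V2 (T (T A)))
    (x : cell ps (tm_hor M) k0 k1) (y : cell qs (fhor T (tm_hor M)) k1 k2) :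
  ⟪ccomp1 c (ccomp2 (tm_mul M) x y)⟫
  = ⟪ccomp1 c x⟫ ⋆ ⟪ccomp1 (act HT a c) y⟫ ⋆ ⟪ccomp0 (nul bar) k2⟫.
Proof.
rewrite <- (pk_eq (ccomp1_assoc2 c (tm_mul M) x y)).
exact (pk_ccomp2_tail x y Hm).
Qed.

Lemma cart_cid : ⟪ccomp1 c (cid (tm_hor M))⟫ = ⟪c⟫.
Proof. apply pk_eq. exact (ccomp_idr c). Qed.

Lemma unit_l_iff :
  ccomp2 (tm_mul M) (tm_unit M) (tcell (η T) (tm_hor M)) ≡ cid (tm_hor M)
  <-> comp2 (whisk_r hat a) (assoc_nat_eq a (eq_sym (tver_nat (η T) a)))
        (whisk_r bar (η T (T A))) ≡ id2 a.
Proof.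
set (ζ := comp2 _ _ _).
assert (H : ⟪ccomp1 c (ccomp2 (tm_mul M) (tm_unit M) (tcell (η T) (tm_hor M)))⟫
  = ⟪c⟫ ⋆ ⟪nul ζ⟫).
{ unfold ζ. rewrite nul_comp2, !(pk_eq (nul_whisk_r _ _)).
  etransitivity; [exact (pk_cart_mul _ _)|].
  rewrite <- !pstar_assoc. apply f_equal2; [|reflexivity].
  transitivity (⟪ccomp0 (nul hat) 𝟙⟫ ⋆ ⟪ccomp1 (Uver (a ∘ η T A)) c⟫).
  { apply f_equal2; apply pk_eq; [|apply act_η].
    apply (ceq_trans He), ceq_sym, ccomp0_vid. }
  (* Interchange: both orders of juxtaposing [hat] with [c] equal the composite of [hat] with [c].
     This moves [hat] behind [c], where it is whiskered by [a]. *)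
  etransitivity; [exact (eq_sym (cell2_nul_l hat c))|].
  etransitivity; [exact (cell2_nul_r hat c)|].
  apply f_equal2; [exact (pk_eq (Uver_vid_ccomp1 c))|reflexivity]. }
assert (E : ⟪c⟫ ⋆ ⟪nul (id2 a)⟫ = ⟪c⟫).
{ etransitivity; [exact (f_equal (fun x => ⟪c⟫ ⋆ x) (pk_eq (nul_Uver a)))|].
  now apply pk_star_un. }
split; intros H1.
- apply nul_inj; [..|apply pk_inj, cart_cancel].
  + rewrite <- vassoc, μ_ηT. apply vidr.
  + apply vidl.
  (* By [H] the product is a packed cell, hence defined, as cancellation demands. *)
  + intros D. discriminate (eq_trans H D).
  + apply (eq_trans (eq_sym H)), (fun e => eq_trans e (eq_sym E)).
    exact (eq_trans (pk_eq (ccomp1_congr (ceq_refl c) H1)) cart_cid).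
- apply (cartesian_inj Hc); [reflexivity|ver|apply μ_ηT|].
  apply pk_inj, (eq_trans H), (fun e => eq_trans e (eq_trans E (eq_sym cart_cid))).
  apply f_equal2; [reflexivity|now apply pk_eq, nul_congr].
Qed.

Lemma unit_r_iff :
  ccomp2 (tm_mul M) (cid (tm_hor M)) (vcast (fver_id T A) eq_refl (fcell T (tm_unit M)))
    ≡ cid (tm_hor M)
  <-> comp2 (whisk_l a (T2 HT hat)) (assoc_fver_eq a a (η T A))
        (whisk_r bar (fver T (η T A))) ≡ id2 a.
Proof.
set (ζ := comp2 _ _ _). set (y := vcast _ _ _).
assert (H : ⟪ccomp1 c (ccomp2 (tm_mul M) (cid (tm_hor M)) y)⟫ = ⟪c⟫ ⋆ ⟪nul ζ⟫).
{ unfold ζ. rewrite nul_comp2, (pk_eq (nul_whisk_r _ _)), (pk_eq (nul_whisk_l _ _)).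
  etransitivity; [exact (pk_cart_mul _ _)|].
  (* On this side [hat] already follows [c], so no interchange occurs: the action on [c] composed
     with the image of the unit is the action on [nul hat]. *)
  rewrite cart_cid. do 2 f_equal. apply pk_eq.
  eapply ceq_trans; [apply ccomp1_congr; [apply ceq_refl|apply ceq_cast]|].
  eapply ceq_trans; [apply ceq_sym, act_ccomp1|].
  eapply ceq_trans; [apply act_congr, He|].
  eapply ceq_trans; [apply act_spec|].
  apply ccomp1_congr; [apply ceq_refl|apply ceq_sym, nul_T2]. }
assert (E : ⟪c⟫ ⋆ ⟪nul (id2 a)⟫ = ⟪c⟫).
{ etransitivity; [exact (f_equal (fun x => ⟪c⟫ ⋆ x) (pk_eq (nul_Uver a)))|].
  now apply pk_star_un. }
split; intros H1.
- apply nul_inj; [..|apply pk_inj, cart_cancel].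
  + rewrite <- vassoc, μ_Tη. apply vidr.
  + ver.
  + intros D. discriminate (eq_trans H D).
  + apply (eq_trans (eq_sym H)), (fun e => eq_trans e (eq_sym E)).
    exact (eq_trans (pk_eq (ccomp1_congr (ceq_refl c) H1)) cart_cid).
- apply (cartesian_inj Hc); [reflexivity|ver|apply μ_Tη|].
  apply pk_inj, (eq_trans H), (fun e => eq_trans e (eq_trans E (eq_sym cart_cid))).
  apply f_equal2; [reflexivity|now apply pk_eq, nul_congr].
Qed.

Lemma assoc_iff :
  ccomp2 (tm_mul M) (cid (tm_hor M)) (vcast (fver_id T A) eq_refl (fcell T (tm_mul M)))
    ≡ ccomp2 (tm_mul M) (tm_mul M) (tcell (μ T) (tm_hor M))
  <-> comp2 (whisk_r bar (fver T (fver T a)))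
        (assoc_nat_eq a (eq_sym (tver_nat (μ T) a)))
        (whisk_r bar (μ T (T A)))
      ≡ comp2 (whisk_l a (T2 HT bar)) (assoc_fver_eq a a (μ T A))
        (whisk_r bar (fver T (μ T A))).
Proof.
set (ζ := comp2 (whisk_r _ _) _ _). set (ζ' := comp2 (whisk_l _ _) _ _).
set (y := vcast _ _ _).
assert (H : ⟪ccomp1 c (ccomp2 (tm_mul M) (cid (tm_hor M)) y)⟫
  = ⟪c⟫ ⋆ ⟪act HT a c⟫ ⋆ ⟪act HT a (act HT a c)⟫ ⋆ ⟪nul ζ'⟫).
{ unfold ζ'. rewrite nul_comp2, (pk_eq (nul_whisk_r _ _)), (pk_eq (nul_whisk_l _ _)).
  etransitivity; [exact (pk_cart_mul _ _)|].
  rewrite cart_cid, <- !pstar_assoc. f_equal. rewrite !pstar_assoc. f_equal.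
  transitivity ⟪act HT a (ccomp1 c (tm_mul M))⟫.
  { apply pk_eq.
    eapply ceq_trans; [apply ccomp1_congr; [apply ceq_refl|apply ceq_cast]|].
    apply ceq_sym, act_ccomp1. }
  (* The lemma [pk_act] takes genuine cells, so the last two factors of [Hm] are first packed as a
     single [star]. *)
  assert (e : a ∘ fver T a = a ∘ fver T a) by reflexivity.
  pose proof (pk_star (act HT a c : cell ⟦_⟧ _ _ _) e (nul bar)) as Hs.
  etransitivity.
  { exact (pk_act HT a (eq_trans Hm (f_equal (fun x => ⟪c⟫ ⋆ x) (eq_sym Hs)))). }
  apply f_equal2; [reflexivity|].
  etransitivity; [exact (pk_act HT a Hs)|]. apply f_equal2; [reflexivity|].
  apply pk_eq. eapply ceq_trans; [apply act_spec|].
  apply ccomp1_congr; [apply ceq_refl|apply ceq_sym, nul_T2]. }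
assert (H' : ⟪ccomp1 c (ccomp2 (tm_mul M) (tm_mul M) (tcell (μ T) (tm_hor M)))⟫
  = ⟪c⟫ ⋆ ⟪act HT a c⟫ ⋆ ⟪act HT a (act HT a c)⟫ ⋆ ⟪nul ζ⟫).
{ unfold ζ. rewrite nul_comp2, !(pk_eq (nul_whisk_r _ _)).
  etransitivity; [exact (pk_cart_mul _ _)|].
  rewrite Hm, !pstar_assoc. do 2 f_equal. rewrite <- !pstar_assoc. f_equal.
  (* Interchange of [bar] with the twice lifted [c] moves [bar] to the right, exchanging [a ∘ μ T A]
     for [a ∘ fver T a] under [Uver]; both sides then have the same prefix. *)
  rewrite (pk_eq (act_act HT a c)), <- cell2_nul_r, cell2_nul_l. f_equal.
  - apply pk_eq. eapply ceq_trans; [apply ceq_sym, ccomp0_vid|].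
    apply ccomp0_congr; [apply ceq_refl|ver].
  - apply pk_eq, act_μ. }
split; intros H1.
- apply nul_inj; [..|apply pk_inj].
  + rewrite <- !vassoc. f_equal. apply μ_μT.
  + ver.
  + assert (D : ⟪c⟫ ⋆ ⟪act HT a c⟫ ⋆ ⟪act HT a (act HT a c)⟫ ⋆ ⟪nul ζ⟫ <> None)
      by (intros D; discriminate (eq_trans H' D)).
    (* The three factors of the common prefix are put back one at a time; each tail is defined
       because the full product is. *)
    apply act_act_cancel; [now do 2 apply pstar_defined_r in D|].
    apply act_cancel; [now apply pstar_defined_r in D|].
    apply cart_cancel; [exact D|].
    apply (eq_trans (eq_sym H')), (fun e => eq_trans e H).
    exact (pk_eq (ccomp1_congr (ceq_refl c) (ceq_sym H1))).
- apply (cartesian_inj Hc); [reflexivity|ver|symmetry; apply μ_μT|].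
  apply pk_inj, (eq_trans H), (fun e => eq_trans e (eq_sym H')).
  do 3 (apply f_equal2; [reflexivity|]). apply pk_eq, nul_congr. now apply ceq_sym.
Qed.

End Comparison.

(** * Normalization, and monoids with representable underlying arrow *)

Section Cartesian.
Context {X : vdc}.

Lemma cartesian_ceq (A0 A1 B0 B1 : X) (p : hor A0 A1) (q : hor B0 B1)
    (f f' : ver A0 B0) (g g' : ver A1 B1) (κ : cell ⟦p⟧ q f g) (κ' : cell ⟦p⟧ q f' g') :
  κ ≡ κ' -> cartesian κ -> cartesian κ'.
Proof.
intros [ep [ef [eg <-]]]. destruct ef, eg.
now rewrite (proof_irrelevance _ ep eq_refl).
Qed.

Lemma cartesian_ex (A0 A1 B0 B1 W0 W1 : X) (p : hor A0 A1) (q : hor B0 B1)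
    (f : ver A0 B0) (g : ver A1 B1) (κ : cell ⟦p⟧ q f g) (rs rs' : path X W0 W1)
    (h : ver W0 A0) (k : ver W1 A1) (u : ver W0 B0) (v : ver W1 B1)
    (α : cell rs' q u v) :
  cartesian κ -> rs' = rs -> u = f ∘ h -> v = g ∘ k ->
  exists β : cell rs p h k, ccomp1 κ β ≡ α.
Proof.
intros Hκ <- -> ->. destruct (Hκ _ _ rs' h k α) as [β [Hβ _]]. now exists β.
Qed.

Lemma cartesian_of_ex_inj (A0 A1 B0 B1 : X) (p : hor A0 A1) (q : hor B0 B1)
    (f : ver A0 B0) (g : ver A1 B1) (κ : cell ⟦p⟧ q f g) :
  (forall (W0 W1 : X) (rs : path X W0 W1) (h : ver W0 A0) (k : ver W1 A1)
     (α : cell rs q (f ∘ h) (g ∘ k)), exists β : cell rs p h k, ccomp1 κ β ≡ α) ->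
  (forall (W0 W1 : X) (rs : path X W0 W1) (h : ver W0 A0) (k : ver W1 A1)
     (β β' : cell rs p h k), ccomp1 κ β ≡ ccomp1 κ β' -> β ≡ β') ->
  cartesian κ.
Proof.
intros He Hi W0 W1 rs h k α. destruct (He _ _ _ _ _ α) as [β Hβ].
exists β. split; [exact Hβ|]. intros β' Hβ'. apply ceq_eq, Hi.
exact (ceq_trans Hβ (ceq_sym Hβ')).
Qed.

Lemma cartesian_comp (A0 A1 B0 B1 C0 C1 : X) (r : hor A0 A1) (p : hor B0 B1)
    (q : hor C0 C1) (h : ver A0 B0) (k : ver A1 B1) (f : ver B0 C0) (g : ver B1 C1)
    (κ : cell ⟦p⟧ q f g) (ε : cell ⟦r⟧ p h k) :
  cartesian κ -> cartesian (ccomp1 κ ε) <-> cartesian ε.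
Proof.
intros Hκ. split; intros Hε; apply cartesian_of_ex_inj.
- intros W0 W1 rs h' k' α.
  destruct (cartesian_ex (rs := rs) (h := h') (k := k') (ccomp1 κ α) Hε)
    as [β Hβ]; try apply happ_nil; try apply vassoc.
  exists β. apply (cartesian_inj Hκ); try reflexivity; [apply happ_nil|].
  exact (ceq_trans (ceq_sym (ccomp1_assoc1 _ _ _)) Hβ).
- intros W0 W1 rs h' k' β β' H. apply (cartesian_inj Hε); try reflexivity.
  eapply ceq_trans; [apply ccomp1_assoc1|].
  eapply ceq_trans; [apply ccomp1_congr; [apply ceq_refl|exact H]|].
  apply ceq_sym, ccomp1_assoc1.
- intros W0 W1 rs h' k' α.
  destruct (cartesian_ex (rs := rs) (h := h ∘ h') (k := k ∘ k') α Hκ)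
    as [β Hβ]; try reflexivity; try (symmetry; apply vassoc).
  destruct (Hε _ _ _ _ _ β) as [β' [Hβ' _]]. exists β'.
  eapply ceq_trans; [apply ccomp1_assoc1|].
  eapply ceq_trans; [apply ccomp1_congr; [apply ceq_refl|exact Hβ']|]. exact Hβ.
- intros W0 W1 rs h' k' β β' H. apply (cartesian_inj Hε); try reflexivity.
  apply (cartesian_inj Hκ); try reflexivity.
  eapply ceq_trans; [apply ceq_sym, ccomp1_assoc1|].
  eapply ceq_trans; [exact H|]. apply ccomp1_assoc1.
Qed.

Lemma hinverse_cartesian (A B : X) (p q : hor A B)
    (φ : cell ⟦p⟧ q (vid A) (vid B)) (ψ : cell ⟦q⟧ p (vid A) (vid B)) :
  hinverse φ ψ -> cartesian φ.
Proof.
intros [H1 H2]. apply cartesian_of_ex_inj.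
- intros W0 W1 rs h k α.
  exists (cast (happ_nil rs) (eq_trans (vidl _) (vidl _)) (eq_trans (vidl _) (vidl _))
    (ccomp1 ψ α)).
  eapply ceq_trans; [apply ccomp1_congr; [apply ceq_refl|apply ceq_cast]|].
  eapply ceq_trans; [apply ceq_sym, ccomp1_assoc1|].
  eapply ceq_trans; [apply ccomp1_congr; [exact H2|apply ceq_refl]|].
  apply ccomp_idl.
- intros W0 W1 rs h k β β' H.
  assert (E : forall γ : cell rs p h k, ccomp1 ψ (ccomp1 φ γ) ≡ γ).
  { intros γ. eapply ceq_trans; [apply ceq_sym, ccomp1_assoc1|].
    eapply ceq_trans; [apply ccomp1_congr; [exact H1|apply ceq_refl]|].
    apply ccomp_idl. }
  apply (ceq_trans (ceq_sym (E β))), (fun e => ceq_trans e (E β')).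
  apply ccomp1_congr; [apply ceq_refl|exact H].
Qed.

End Cartesian.

Section Normality.
Context {X : vequipment}.

Lemma pk_ccomp0 (A B C : X) (k : ver A B) (f f' g g' h h' : ver B C)
    (γ : cell (hnil B) (U C) f' h') (α : cell (hnil B) (U C) f g)
    (β : cell (hnil B) (U C) g' h) :
  ⟪γ⟫ = ⟪α⟫ ⋆ ⟪β⟫ -> ⟪ccomp0 γ k⟫ = ⟪ccomp0 α k⟫ ⋆ ⟪ccomp0 β k⟫.
Proof.
exact (pk_ccomp (ps := hnil B) (qs := hnil B) (csnil _ k) (csnil _ k)).
Qed.

(** Composing with a 2-cell into the identity is juxtaposing with its nullary form on the right.
    This is why factoring through [ξ] amounts to inverting it. *)
Lemma cell2_vid (A W0 W1 : X) (f : ver A A) (ξ : cell2 f (vid A)) (ps : path X W0 W1)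
    (h : ver W0 A) (k : ver W1 A) (α : cell ps (U A) h k) :
  ⟪ccomp1 ξ α⟫ = ⟪α⟫ ⋆ ⟪ccomp0 (nul ξ) k⟫.
Proof. now rewrite cell2_nul_r, (pk_eq (Uver_vid_ccomp1 α)). Qed.

Lemma cartesian_cell2 (A : X) (f : ver A A) (ξ : cell2 f (vid A)) :
  cartesian ξ <-> iso2 ξ.
Proof.
split.
- intros Hξ.
  (* The inverse of [ξ] is the factorization of the identity 2-cell of [f] through it. *)
  destruct (cartesian_ex (rs := hnil A) (h := f) (k := vid A) (un f) Hξ)
    as [β Hβ]; try ver.
  assert (H : ⟪β⟫ ⋆ ⟪nul ξ⟫ = ⟪un f⟫).
  { rewrite <- (pk_eq Hβ), (cell2_vid ξ β). f_equal. apply pk_eq, ceq_sym, ccomp0_vid. }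
  exists (ulift β : cell2 (vid A) f). split; apply ceq_eq, nul_inj; try reflexivity;
    apply pk_inj; rewrite nul_comp2.
  + rewrite (pk_eq (nul_ulift β)). etransitivity; [exact H|].
    apply pk_eq, ceq_sym, nul_Uver.
  + rewrite (pk_eq (nul_ulift β)).
    rewrite <- (pk_star (nul ξ) eq_refl β).
    etransitivity; [|exact (eq_sym (pk_eq (nul_Uver (vid A))))].
    (* After composition with [ξ] the other inverse law reads [ξ ⋆ β ⋆ ξ = ξ] on nullary forms,
       which follows from [H]. *)
    apply pk_eq, (cartesian_inj Hξ); try reflexivity.
    apply pk_inj. rewrite !cell2_vid, !(pk_eq (ccomp0_vid (nul ξ))).
    rewrite pk_star, pstar_assoc, H, pk_un_star by reflexivity.
    now apply pk_star_un.
- intros [ζ [H1 H2]].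
  assert (E1 : ⟪un f⟫ = ⟪nul ζ⟫ ⋆ ⟪nul ξ⟫).
  { rewrite <- nul_comp2 with (e := eq_refl). rewrite H1.
    apply pk_eq, ceq_sym, nul_Uver. }
  assert (E2 : ⟪un (vid A)⟫ = ⟪nul ξ⟫ ⋆ ⟪nul ζ⟫).
  { rewrite <- nul_comp2 with (e := eq_refl). rewrite H2.
    apply pk_eq, ceq_sym, nul_Uver. }
  apply cartesian_of_ex_inj.
  + intros W0 W1 rs h k α.
    exists (cast (happ_nil rs) (vidl h) (vidl k) (star α eq_refl (ccomp0 (nul ζ) k))).
    apply pk_inj. rewrite cell2_vid, pk_cast, pk_star, pstar_assoc.
    rewrite <- (pk_ccomp0 k E1), (pk_eq (ccomp0_un f k)). now apply pk_star_un.
  + intros W0 W1 rs h k β β' H. apply pk_inj.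
    assert (E : forall γ : cell rs (U A) h k,
      ⟪γ⟫ = ⟪ccomp1 ξ γ⟫ ⋆ ⟪ccomp0 (nul ζ) k⟫).
    { intros γ. rewrite cell2_vid, pstar_assoc, <- (pk_ccomp0 k E2).
      rewrite (pk_eq (ccomp0_un (vid A) k)). symmetry. apply pk_star_un. ver. }
    now rewrite (E β), (E β'), (pk_eq H).
Qed.

End Normality.

(** * Splitting off a factor by a triangle identity *)

Section UnitAction.
Context {X : vequipment} {A B C : X} {E : hor A A}
  {γ : cell (hnil A) E (vid A) (vid A)} {P : hor A C}
  {Λ : cell ⟦E; P⟧ P (vid A) (vid C)} {f : ver A B} {D : cell ⟦E⟧ (U B) f f}
  (Hγ : opcartesian γ) (HΛ : ccomp2 Λ γ (cid P) ≡ cid P) (HD : ccomp1 D γ ≡ un f)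
  {W : X} {ps : path X A W} {qs : path X W C} {h : ver A A} {k : ver W A}
  {x : cell ps E h k} {y : cell qs P k (vid C)} (Hxy : ccomp2 Λ x y ≡ cid P).

(** Acting by the unit [E] and then applying [N] is [D ⋆ N], as one sees on [γ]; substituting [x]
    and [y], on which the action is the identity, gives the splitting. The unit is an arbitrary [E]
    because the splitting is also applied to [fhor T (U A)]. *)
Lemma unit_action_factor1 (g : ver C B) (N : cell ⟦P⟧ (U B) f g) :
  ⟪N⟫ = ⟪ccomp1 D x⟫ ⋆ ⟪ccomp1 N y⟫.
Proof.
assert (H : ccomp1 N Λ ≡ ccomp2 (umult B) D N).
{ apply (opcartesian_inj (ss := ⟦P⟧) Hγ); try ver.
  eapply ceq_trans; [exact (ccomp1_assoc2 N Λ γ (cid P))|].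
  eapply ceq_trans; [apply ccomp1_congr; [apply ceq_refl|exact HΛ]|].
  eapply ceq_trans; [exact (ccomp_idr N)|].
  apply ceq_sym, pk_inj.
  etransitivity.
  { exact (pk_ccomp2 γ (cid P) (pk_umult D N)). }
  rewrite (pk_eq HD), pk_un_star by ver. exact (pk_eq (ccomp_idr N)). }
transitivity ⟪ccomp2 (ccomp1 N Λ) x y⟫.
{ apply pk_eq, ceq_sym. eapply ceq_trans; [apply ccomp1_assoc2|].
  eapply ceq_trans; [apply ccomp1_congr; [apply ceq_refl|exact Hxy]|].
  exact (ccomp_idr N). }
exact (pk_ccomp2 x y (eq_trans (pk_eq H) (pk_umult D N))).
Qed.

(** The same argument with a further arrow [Q] carried along by identity cells. *)
Lemma unit_action_factor2 (C' : X) (Q : hor C C') (g : ver C' B)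
    (N : cell ⟦P; Q⟧ (U B) f g) :
  ⟪N⟫ = ⟪ccomp1 D x⟫ ⋆ ⟪ccomp2 N y (cid Q)⟫.
Proof.
assert (HQ : ccomp1 (cid Q) (cid Q) ≡ cid Q) by apply ccomp_idl.
assert (H : ccomp2 N Λ (cid Q) ≡ ccomp2 (umult B) D N).
{ apply (opcartesian_inj (ss := ⟦P; Q⟧) Hγ); try ver.
  eapply ceq_trans.
  { exact (ccomp2_assoc N Λ (cid Q) (cscons γ (cscons (cid P) (csnil _ _)))
      (cscons (cid Q) (csnil _ _))). }
  eapply ceq_trans.
  { apply ccomp2_congr with (α' := cid P) (β' := cid Q);
      [apply ceq_refl|exact HΛ|exact HQ]. }
  eapply ceq_trans; [exact (ccomp_idr N)|].
  apply ceq_sym, pk_inj.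
  etransitivity.
  { exact (pk_ccomp (ps := ⟦E⟧) (qs := ⟦P; Q⟧) (cscons γ (csnil _ _))
      (cscons (cid P) (cscons (cid Q) (csnil _ _))) (pk_umult D N)). }
  etransitivity; [exact (f_equal (fun z => z ⋆ _) (pk_eq HD))|].
  rewrite pk_un_star by ver. exact (pk_eq (ccomp_idr N)). }
transitivity ⟪ccomp2 N (ccomp2 Λ x y) (ccomp1 (cid Q) (cid Q))⟫.
{ apply pk_eq, ceq_sym.
  eapply ceq_trans; [apply ccomp2_congr; [apply ceq_refl|exact Hxy|exact HQ]|].
  exact (ccomp_idr N). }
transitivity ⟪ccomp (ccomp2 N Λ (cid Q)) (cscons x (cscons y (cscons (cid Q) (csnil _ _))))⟫.
{ apply pk_eq, ceq_sym.
  exact (ccomp2_assoc N Λ (cid Q) (cscons x (cscons y (csnil _ _)))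
    (cscons (cid Q) (csnil _ _))). }
exact (pk_ccomp (ps := ⟦E⟧) (qs := ⟦P; Q⟧) (cscons x (csnil _ _))
  (cscons y (cscons (cid Q) (csnil _ _))) (eq_trans (pk_eq H) (pk_umult D N))).
Qed.

End UnitAction.

Section Factorization.
Context {X : vequipment} {T : vmonad X} (HT : normal_functor T) {A : X}
  {a : ver (T A) A} {M : hor A (T A)} {c : cell ⟦M⟧ (U A) (vid A) a}.
Hypothesis Hc : cartesian c.

(* The unit [d] of the conjoint and the action [Λ] of [U A] on [M] satisfy
   [Λ(c, d) = 1]: the triangle identity through which [c] and [act c] split off. *)
Lemma mul_factor (g : ver (T (T A)) A) (N : cell ⟦M; fhor T M⟧ (U A) (vid A) g) :
  exists bar : cell2 g (a ∘ fver T a), ⟪N⟫ = ⟪c⟫ ⋆ ⟪act HT a c⟫ ⋆ ⟪nul bar⟫.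
Proof.
destruct (cartesian_ex (rs := hnil (T A)) (h := a) (k := vid (T A)) (un a) Hc)
  as [d Hd]; try ver.
destruct (cartesian_ex (rs := ⟦U A; M⟧) (h := vid A) (k := vid (T A))
  (ccomp2 (umult A) (cid (U A)) c) Hc) as [Λ HΛ]; try ver.
assert (HΛc : forall (W0 W1 W2 : X) (ps : path X W0 W1) (qs : path X W1 W2)
    (h : ver W0 A) (k : ver W1 A) (l : ver W2 (T A))
    (x : cell ps (U A) h k) (y : cell qs M k l),
  ⟪ccomp1 c (ccomp2 Λ x y)⟫ = ⟪x⟫ ⋆ ⟪ccomp1 c y⟫).
{ intros. rewrite <- (pk_eq (ccomp1_assoc2 c Λ x y)).
  rewrite (pk_ccomp2 x y (eq_trans (pk_eq HΛ) (pk_umult _ _))).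
  f_equal. apply pk_eq, ccomp_idl. }
assert (H1 : ccomp2 Λ (ucell A) (cid M) ≡ cid M).
{ apply (cartesian_inj Hc); try ver. apply pk_inj.
  etransitivity; [exact (HΛc _ _ _ _ _ _ _ _ (ucell A) (cid M))|].
  rewrite <- (pk_eq (ccomp0_vid (ucell A))), <- (pk_eq (un_spec (vid A))).
  apply pk_un_star. ver. }
assert (H2 : ccomp2 Λ c d ≡ cid M).
{ apply (cartesian_inj Hc); try ver. apply pk_inj.
  etransitivity; [exact (HΛc _ _ _ _ _ _ _ _ c d)|].
  rewrite (pk_eq Hd), pk_star_un by reflexivity. symmetry. exact (pk_eq (ccomp_idr c)). }
assert (HD : ccomp1 (cid (U A)) (ucell A) ≡ un (vid A)).
{ eapply ceq_trans; [apply ccomp_idl|].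
  apply ceq_sym, (ceq_trans (un_spec _)), ccomp0_vid. }
(* The first splitting, for the unit [U A], takes [c] off [N] and leaves [N] with its first slot
   filled by [d]; this remainder is [K]. *)
pose proof (unit_action_factor2 (@ucell_opcart X A) H1 HD H2 N) as HN.
rewrite (pk_eq (ccomp_idl c)) in HN.
pose (K := vcast (vidl a) (vidr g) (ccomp2 N d (cid (fhor T M)) : cell ⟦_⟧ _ _ _)).
pose (Λ' := vcast (fver_id T A) (fver_id T (T A)) (fcell T Λ : cell ⟦_; _⟧ _ _ _)).
(* The left boundary of [K] is [a], so the second splitting needs the extension of [un a] along the
   image of the unit cell. *)
pose (D := vcast (vidr a) (vidr a) (ccomp1 (Uver a) (TU HT A))).
pose (d' := vcast eq_refl (fver_id T (T A)) (fcell T d : cell (hnil _) _ _ _)).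
assert (H1' : ccomp2 Λ' (Tucell T A) (cid (fhor T M)) ≡ cid (fhor T M)).
{ eapply ceq_trans.
  { apply ccomp2_congr; [apply ceq_cast|apply Tucell_spec|apply ceq_sym, fcell_id]. }
  eapply ceq_trans; [apply ceq_sym, fcell_ccomp2|].
  eapply ceq_trans; [apply fcell_congr, H1|]. apply fcell_id. }
assert (H2' : ccomp2 Λ' (fcell T c : cell ⟦_⟧ _ _ _) d' ≡ cid (fhor T M)).
{ eapply ceq_trans.
  { apply ccomp2_congr; [apply ceq_cast|apply ceq_refl|apply ceq_cast]. }
  eapply ceq_trans; [exact (ceq_sym (fcell_ccomp2 T Λ c d))|].
  eapply ceq_trans; [apply fcell_congr, H2|]. apply fcell_id. }
assert (HD' : ccomp1 D (Tucell T A) ≡ un a).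
{ eapply ceq_trans; [apply ccomp1_congr; [apply ceq_cast|apply ceq_refl]|].
  eapply ceq_trans; [apply ccomp1_assoc1|].
  eapply ceq_trans; [apply ccomp1_congr; [apply ceq_refl|apply TU_Tucell]|].
  apply Uver_ucell. }
(* The image under [T] of the same triangle identity takes the action on [c] off [K]; what remains
   is nullary and is the required 2-cell. *)
pose proof (unit_action_factor1 (Tucell_opcart HT (A := A)) H1' HD' H2' K) as HK.
exists (ulift (vcast eq_refl (vidr g) (ccomp1 K d'))).
rewrite HN. f_equal.
transitivity ⟪K⟫; [symmetry; apply pk_cast|]. rewrite HK. apply f_equal2.
- apply pk_eq.
  eapply ceq_trans; [apply ccomp1_congr; [apply ceq_cast|apply ceq_refl]|].
  eapply ceq_trans; [apply ccomp1_assoc1|].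
  apply ceq_sym. eapply ceq_trans; [apply act_spec|].
  apply ccomp1_congr; [apply ceq_refl|exact (That_spec HT c)].
- symmetry. etransitivity; [exact (pk_eq (nul_ulift _))|]. apply pk_cast.
Qed.

End Factorization.

Theorem theorem9p2 (X : vequipment) (T : vmonad X) (HT : normal_functor T) :
  (forall (A : X) (a : oplax_algebra HT A),
      is_tmonoid (arising_tmonoid a)
      /\ (tm_normalized (arising_tmonoid a) <-> oplax_normal a))
  /\ (forall (A : X) (M : tmonoid_data T A), is_tmonoid M ->
      ((exists a : oplax_algebra HT A, tm_iso M (arising_tmonoid a))
       <-> (exists a : ver (T A) A, hiso (tm_hor M) (conj a)))).
Proof.
split.
- intros A a.
  pose proof (@rescell_cart X _ _ _ _ (U A) (alg a) (vid A)) as Hc.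
  pose proof (arising_mul_spec a) as Hm. pose proof (arising_unit_spec a) as He.
  split; [split; [|split]|].
  + apply (assoc_iff (M := arising_tmonoid a) Hc Hm), oplax_assoc.
  + apply (unit_l_iff (M := arising_tmonoid a) Hc Hm He), oplax_unit_l.
  + apply (unit_r_iff (M := arising_tmonoid a) Hc Hm He), oplax_unit_r.
  + unfold oplax_normal. rewrite <- cartesian_cell2.
    unfold tm_normalized. rewrite <- (cartesian_comp _ Hc).
    (* As the cell of the conjoint is cartesian, the unit is cartesian if and only if its composite
       with that cell is, and this composite is [ahat a]. *)
    assert (E : ccomp1 (conj_cell (alg a)) (ulift (arising_unit a)) ≡ ahat a).
    { apply ucell_inj; try ver. eapply ceq_trans; [apply ccomp1_assoc1|].
      eapply ceq_trans; [apply ccomp1_congr; [apply ceq_refl|apply ulift_spec]|].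
      apply (ceq_trans He), nul_spec. }
    split; apply cartesian_ceq; [exact E|exact (ceq_sym E)].
- intros A M [Ma [Ml Mr]]. split.
  { intros [a [φ [ψ [H _]]]]. now exists (alg a), φ, ψ. }
  intros [a [φ [ψ Hφ]]].
  pose (c0 := conj_cell a).
  assert (Hc0 : cartesian c0) by apply rescell_cart.
  (* The cartesian cell of the conjoint is carried over to [M] along the isomorphism. *)
  pose (c := vcast (vidl (vid A)) (vidr a) (ccomp1 c0 φ : cell ⟦tm_hor M⟧ _ _ _)).
  assert (Ec : c ≡ ccomp1 c0 φ) by apply ceq_cast.
  assert (Hc : cartesian c).
  { apply (cartesian_ceq (ceq_sym Ec)), (cartesian_comp φ Hc0).
    exact (hinverse_cartesian Hφ). }
  destruct (mul_factor HT Hc (vcast (vidl (vid A)) eq_refl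
    (ccomp1 c (tm_mul M) : cell ⟦_; _⟧ _ _ _))) as [bar Hm].
  rewrite pk_cast in Hm.
  (* Just as [bar] is read off from the multiplication, [hat] is read off from the unit; the axioms
     of [M] then become those of an oplax algebra. *)
  pose (hat := ulift (vcast (vidl (vid A)) eq_refl (ccomp1 c (tm_unit M))) 
    : cell2 (a ∘ η T A) (vid A)).
  assert (He : ccomp1 c (tm_unit M) ≡ nul hat).
  { apply ceq_sym. eapply ceq_trans; [apply nul_ulift|apply ceq_cast]. }
  pose (b := @OplaxAlgebra X T HT A a bar hat
    (proj1 (assoc_iff (M := M) Hc Hm) Ma) (proj1 (unit_l_iff (M := M) Hc Hm He) Ml)
    (proj1 (unit_r_iff (M := M) Hc Hm He) Mr)).
  exists b, φ, ψ. split; [exact Hφ|split].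
  (* Compatibility of [φ] with the multiplications is checked after composing with [c0]. Both sides
     become the product of [c], the action on [c] and [bar], because [c] is [c0] after [φ] and the
     action respects composition. *)
  + apply (cartesian_inj Hc0); [reflexivity|ver|ver|]. apply pk_inj.
    etransitivity; [|exact (eq_sym (pk_cart_mul (M := arising_tmonoid b)
      (arising_mul_spec b) φ (vcast (fver_id T A) eq_refl (fcell T φ))))].
    transitivity ⟪ccomp1 c (tm_mul M)⟫.
    { apply pk_eq. eapply ceq_trans; [apply ceq_sym, ccomp1_assoc1|].
      apply ccomp1_congr; [exact (ceq_sym Ec)|apply ceq_refl]. }
    etransitivity; [exact Hm|].
    apply f_equal2; [exact (pk_eq Ec)|]. apply f_equal2; apply pk_eq.
    * eapply ceq_trans; [apply act_congr, Ec|].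
      eapply ceq_trans; [apply act_ccomp1|].
      apply ccomp1_congr; [apply ceq_refl|apply ceq_sym, ceq_cast].
    * eapply ceq_trans; [apply ceq_sym, ccomp0_vid|].
      apply ccomp0_congr; [apply ceq_refl|ver].
  + apply (cartesian_inj Hc0); [reflexivity|ver|ver|].
    eapply ceq_trans; [apply ceq_sym, ccomp1_assoc1|].
    eapply ceq_trans; [apply ccomp1_congr; [exact (ceq_sym Ec)|apply ceq_refl]|].
    apply (ceq_trans He), ceq_sym. exact (arising_unit_spec b).
Qed.
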